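(* Let $(a,D[a])$ be a strongly local Dirichlet form on $L^2(X,m(dx))$ that satisfies (a1), (a2), (a3). Let $\psi:X\to\mathbf{R}$ be a quasi-continuous function such that the closed convex set $$K_\psi:=\{v\in D[a]:v\ge\psi\ \ m\text{-a.e. on }X\}$$ is non-empty, and let $f\in(D[a])'$. Assume that there exists a unique solution $\tilde u$ to the obstacle problem $$u\in K_\psi,\qquad a[u,v-u]\ge\langle f,v-u\rangle\quad\text{for all }v\in K_\psi,$$ and let $I:=\{x\in X:\tilde u(x)=\psi(x)\}$. Then $$L\tilde u=f\quad\text{on }X\setminus I.$$ Furthermore, if the obstacle function $\psi$ is equal to a constant function, then $$L\tilde u=0\quad\text{on }I,$$ i.e. $\displaystyle\int_X\chi_I(x)\,\mu[\tilde u,v](dx)=0$ for every $v\in D[a]$.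
   Context: $X$ is a locally compact separable Hausdorff space and $m(dx)$ is a (non-negative) Radon measure on $X$ with support equal to $X$ (finite on compact sets, strictly positive on non-empty open sets). $(u,v)$ is the inner product of the real space $L^2(X,m(dx))$, $\chi_E$ is the indicator function of $E$, and $C(X)$ is the space of real continuous functions on $X$. A Dirichlet form $(a,D[a])$ on $L^2(X,m(dx))$ is a symmetric non-negative bilinear form $a[u,v]$ defined on a dense subspace $D[a]$ of $L^2(X,m(dx))$, such that $D[a]$ is a Hilbert space under the intrinsic norm $(a[u,u]+(u,u))^{1/2}$, and which is Markovian: if $u\in D[a]$ then $v=\min\{1,\max\{u,0\}\}\in D[a]$ and $a[v,v]\le a[u,u]$. The form is strongly local if $a[u,v]=0$ whenever $u,v\in D[a]$ and $u$ is constant on the support of $v$. A strongly local form is written $a[u,v]=\int_X\mu[u,v](dx)$, $u,v\in D[a]$, where $\mu[u,v](dx)$ is a signed Borel measure (the energy measure); $(u,v)\mapsto\mu[u,v]$ is a symmetric non-negative bilinear map, assumed to have the localization property: if $G\subset X$ is open and $u=v$ $m$-a.e. on $G$, then $\chi_G(x)\mu[u,u](dx)=\chi_G(x)\mu[v,v](dx)$. (a1) The embedding $D[a]\hookrightarrow L^2(X,m(dx))$ is compact. (a2) For every compact set $K$ and each relatively compact open set $G\subset X$ with $K\subset G$, there exists $u\in D[a]$ with $u=1$ on $K$ and $u=0$ on $X\setminus G$. (a3) $C(X)\cap D[a]$ is dense in $D[a]$ (with respect to the intrinsic norm) and in $C(X)$ (with respect to uniform convergence on compact sets). $(D[a])'$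 is the dual of $D[a]$ and $\langle\cdot,\cdot\rangle$ the duality pairing. For $\phi\in D[a]$, $L\phi\in(D[a])'$ is defined by $\langle L\phi,v\rangle=a[\phi,v]$. ''$L\tilde u=f$ on $X\setminus I$'' means $a[\tilde u,\zeta]=\langle f,\zeta\rangle$ for every $\zeta\in D[a]$ with support contained in $X\setminus I$. Capacity: for $G$ open, $\mathrm{Cap}(G)=\inf\{a[u,u]+(u,u):u\in D[a],\ u\ge1\ m\text{-a.e. on }G\}$ (with $\inf\emptyset=+\infty$), and $\mathrm{Cap}(E)=\inf\{\mathrm{Cap}(G):G\supset E\text{ open}\}$ for general $E$. A function is quasi-continuous if there is an increasing sequence of closed sets $F_k$ with $\mathrm{Cap}(X\setminus F_k)\to0$ such that its restriction to each $F_k$ is continuous. Each $u\in D[a]$ has a quasi-continuous representative, and $\tilde u$ is identified with such a representative in the definition of $I$.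
   Formalization: Lũ=f on X∖I is tested only on ζ in the D[a]-closure of compactly supported elements (it fails for H¹(0,1), ψ=-x, f(v)=-v(0)); μ[u,u] is also required to be Radon and to satisfy ∫φdμ[u,u]=a[u,φu]-½a[u²,φ] for bounded u and continuous compactly supported φ in D[a]. *)

(* Defs.v *)
From HB Require Import structures.
From mathcomp Require Import all_boot all_order all_algebra.
From mathcomp Require Import all_classical all_reals all_analysis.

Set Implicit Arguments.
Unset Strict Implicit.
Unset Printing Implicit Defensive.
Import Order.TTheory GRing.Theory Num.Theory.
Import numFieldNormedType.Exports.

Local Open Scope classical_set_scope.
Local Open Scope ring_scope.

Notation borel X := (g_sigma_algebraType (@open X)).

Definition separable_space (X : topologicalType) : Prop :=
  exists2 S : set X, countable S & dense S.

(* On a locally compact space with a countable base the two regularity clauses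
   hold for every Borel measure that is finite on compact sets. *)
Definition radon_measure (R : realType) (X : ptopologicalType)
    (nu : {measure set (borel X) -> \bar R}) : Prop :=
  [/\ forall K : set X, compact K -> (nu K < +oo)%E,
      forall A : set (borel X), measurable A ->
        nu A = ereal_inf [set nu G | G in [set G : set X | open G /\ A `<=` G]] &
      forall G : set X, open G ->
        nu G = ereal_sup [set nu K | K in [set K : set X | compact K /\ K `<=` G]]].

Definition full_support (R : realType) (X : ptopologicalType)
    (m : {measure set (borel X) -> \bar R}) : Prop :=
  forall G : set X, open G -> G !=set0 -> (0 < m G)%E.

(* An element of L^2(X,m) is represented by any of its Borel members, so a
   subspace of L^2(X,m) is a set of functions that is saturated under equality
   m-a.e., and a form on it is a function of representatives that does not
   distinguish functions equal m-a.e. *)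

Section DirichletForms.
Context {R : realType} {X : ptopologicalType}.
Variable m : {measure set (borel X) -> \bar R}.

Definition L2 : set (X -> R) :=
  [set u | (u : borel X -> R) \in Lfun m 2%:E].

Definition ip (u v : X -> R) : R := \int[m]_x (u x * v x).

Definition l2norm (u : X -> R) : R := Num.sqrt (ip u u).

Definition inorm (a : (X -> R) -> (X -> R) -> R) (u : X -> R) : R :=
  Num.sqrt (a u u + ip u u).

(* The support of the measure u m: complement of the largest open set on which
   u vanishes m-a.e. *)
Definition supp (u : X -> R) : set X :=
  ~` \bigcup_(G in [set G : set X | open G /\
                      {ae m, forall x, G x -> u x = 0}]) G.

Variables (D : set (X -> R)) (a : (X -> R) -> (X -> R) -> R).

Record dirichlet_form : Prop := DirichletForm {
  df_L2 : D `<=` L2 ;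
  df_saturated : forall u v, D u -> L2 v ->
    {ae m, forall x, u x = v x} -> D v ;
  df_zero : D (fun=> 0) ;
  df_linear : forall c u v, D u -> D v -> D (fun x => c * u x + v x) ;
  df_dense : forall g, L2 g -> forall e : R, 0 < e ->
    exists2 u, D u & l2norm (g \- u) < e ;
  df_ae : forall u v w, D u -> D v -> D w ->
    {ae m, forall x, u x = v x} -> a u w = a v w ;
  df_sym : forall u v, D u -> D v -> a u v = a v u ;
  df_bilinear : forall c u v w, D u -> D v -> D w ->
    a (fun x => c * u x + v x) w = c * a u w + a v w ;
  df_ge0 : forall u, D u -> 0 <= a u u ;
  df_complete : forall w : nat -> X -> R, (forall n, D (w n)) ->
    (forall e : R, 0 < e -> exists N : nat, forall i j,
       (N <= i)%N -> (N <= j)%N -> inorm a (w i \- w j) < e) ->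
    exists2 u, D u & inorm a (w n \- u) @[n --> \oo] --> (0 : R) ;
  df_markov : forall u, D u ->
    let v := fun x => Num.min 1 (Num.max (u x) 0) in
    D v /\ a v v <= a u u }.

Definition strongly_local : Prop :=
  forall u v (c : R), D u -> D v ->
    {ae m, forall x, supp v x -> u x = c} -> a u v = 0.

(* The identity in the last field is the one that defines the energy measure
   of a strongly local form, in the normalization a[u,u] = mu[u,u](X).  The
   other fields alone do not determine mu: on H^1_0(0,1), with
   b x = 1 / (2 - x), the assignment
     (u,v) |-> (u' + b u) (v' + b v) dx
   also satisfies them for a[u,v] = \int u' v' dx.
   The diagonal charge mu[u,u] is exhibited as a measure nu, against which the
   library can integrate. *)
Record energy_measure
    (mu : (X -> R) -> (X -> R) -> {charge set (borel X) -> \bar R}) : Prop :=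
  EnergyMeasure {
  em_sym : forall u v (A : set (borel X)), D u -> D v -> measurable A ->
    mu u v A = mu v u A ;
  em_bilinear : forall c u v w (A : set (borel X)),
    D u -> D v -> D w -> measurable A ->
    mu (fun x => c * u x + v x) w A = (c%:E * mu u w A + mu v w A)%E ;
  em_ge0 : forall u (A : set (borel X)), D u -> measurable A ->
    (0 <= mu u u A)%E ;
  em_total : forall u v, D u -> D v -> mu u v setT = (a u v)%:E ;
  em_localization : forall (G : set X) u v, open G -> D u -> D v ->
    {ae m, forall x, G x -> u x = v x} ->
    forall A : set (borel X), measurable A ->
      mu u u (A `&` G) = mu v v (A `&` G) ;
  em_energy : forall u, D u ->
    exists nu : {finite_measure set (borel X) -> \bar R},
      [/\ forall A : set (borel X), measurable A -> mu u u A = nu A,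
          radon_measure nu &
          (exists M : R, forall x, `|u x| <= M) ->
          forall phi : X -> R, D phi -> continuous phi ->
            compact (closure [set x | phi x != 0]) ->
            \int[nu]_x phi x =
              a u (fun x => u x * phi x) - 2^-1 * a (fun x => u x ^+ 2) phi] }.

Definition compact_embedding : Prop :=
  forall w : nat -> X -> R, (forall n, D (w n)) ->
    (exists M : R, forall n, inorm a (w n) <= M) ->
    exists (s : nat -> nat) (u : X -> R),
      [/\ forall i j, (i < j)%N -> (s i < s j)%N, L2 u &
          l2norm (w (s n) \- u) @[n --> \oo] --> (0 : R)].

Definition has_cutoffs : Prop :=
  forall K G : set X, compact K -> open G -> precompact G -> K `<=` G ->
    exists u, [/\ D u, forall x, K x -> u x = 1 & forall x, ~ G x -> u x = 0].

Definition continuous_dense : Prop :=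
  (forall u, D u -> forall e : R, 0 < e ->
     exists g : X -> R, [/\ continuous g, D g & inorm a (u \- g) < e]) /\
  (forall h : X -> R, continuous h ->
     forall K : set X, compact K -> forall e : R, 0 < e ->
     exists g : X -> R,
       [/\ continuous g, D g & forall x, K x -> `|h x - g x| < e]).

Definition cap_open (G : set X) : \bar R :=
  ereal_inf [set (a u u + ip u u)%:E | u in
    [set u | D u /\ {ae m, forall x, G x -> 1 <= u x}]].

Definition cap (E : set X) : \bar R :=
  ereal_inf [set cap_open G | G in [set G : set X | open G /\ E `<=` G]].

Definition quasi_continuous (u : X -> R) : Prop :=
  exists F : nat -> set X,
    [/\ forall k, closed (F k), forall k, F k `<=` F k.+1,
        cap (~` F k) @[k --> \oo] --> 0%E &
        forall k, {within F k, continuous u}].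

Definition in_dual (f : (X -> R) -> R) : Prop :=
  (forall c u v, D u -> D v -> f (fun x => c * u x + v x) = c * f u + f v) /\
  (exists C : R, forall u, D u -> `|f u| <= C * inorm a u).

Definition obstacle_set (psi : X -> R) : set (X -> R) :=
  [set v | D v /\ {ae m, forall x, psi x <= v x}].

Definition obstacle_solution (psi : X -> R) (f : (X -> R) -> R)
    (u : X -> R) : Prop :=
  obstacle_set psi u /\
  forall v, obstacle_set psi v -> f (v \- u) <= a u (v \- u).

(* Closure in D[a] of the elements of compact support: all of D[a] when X is
   compact, and, more generally, when the form is regular. *)
Definition compactly_approximable : set (X -> R) :=
  [set z | D z /\ forall e : R, 0 < e ->
    exists g, [/\ D g, compact (supp g) & inorm a (z \- g) < e]].

(* L u = f on E.  Without compactly_approximable, the equation would also test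
   at the "boundary at infinity" of X: for a[u,v] = \int u' v' dx on H^1(0,1),
   viewed on X = ]0,1[, with obstacle psi x = - x and <f,v> = - v(0), the
   solution is 0, it touches psi nowhere on X, and yet L 0 <> f. *)
Definition equation_on (u : X -> R) (f : (X -> R) -> R) (E : set X) : Prop :=
  forall z, D z -> supp z `<=` E -> compactly_approximable z -> a u z = f z.

End DirichletForms.

(* Main.v *)
Require Import Defs.
From HB Require Import structures.
From mathcomp Require Import finmap.
From mathcomp Require Import all_boot all_order all_algebra.
From mathcomp Require Import all_classical all_reals all_analysis.
From mathcomp Require Import measurable_realfun ring lra.
Import Order.TTheory GRing.Theory Num.Theory.
Import numFieldNormedType.Exports.
Local Open Scope classical_set_scope.
Local Open Scope ring_scope.

(* Both parts rest on weak closedness: a convex, norm-closed subset of D[a]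
   contains the L^2-limits of its energy-bounded sequences.

   First part: a nonnegative bounded z in D[a] of compact support off I is
   replaced by (z - M e)^+, where M bounds z and e has small energy and is at
   least 1 off a closed set F on which u and psi are continuous.  On the compact
   set where (z - M e)^+ lives, u - psi is bounded below by a positive constant,
   so u may be varied in both directions along (z - M e)^+, which converges
   weakly to z as the energy of e tends to 0.

   Second part: mu[u,u] vanishes on every level set {u = c}, and then so does
   mu[u,v], by the Cauchy-Schwarz inequality.  The functions whose energy measure
   does not charge {u = c} form a norm-closed subspace of D[a].  For c >= 0, u is
   the combination of u^-, (u - c)^+ and min(c, u^+), and each of these is a weak
   limit of functions that, up to scaling, are a.e. equal to 0 or a.e. equal to 1
   on an open set containing {u = c}.  The energy measure of such a function does
   not charge the open set: by localization when the value is 0, and by strong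
   locality and the formula defining the energy measure when it is 1. *)

(** * Square integrable functions and the L^2 inner product *)

Section square_integrable_functions.
Context {R : realType} {X : ptopologicalType}.
Context (m : {measure set (borel X) -> \bar R}).
Implicit Types u v g h : X -> R.

Lemma ae_mono (P Q : X -> Prop) : (forall x, P x -> Q x) ->
  {ae m, forall x, P x} -> {ae m, forall x, Q x}.
Proof. by move=> PQ; apply: (@filterS _ _ (ae_filter_ringOfSetsType m)). Qed.

Lemma ae_mono2 (P Q S : X -> Prop) : (forall x, P x -> Q x -> S x) ->
  {ae m, forall x, P x} -> {ae m, forall x, Q x} -> {ae m, forall x, S x}.
Proof. by move=> PQ; apply: (@filterS2 _ _ (ae_filter_ringOfSetsType m)). Qed.

Lemma ae_true (P : X -> Prop) : (forall x, P x) -> {ae m, forall x, P x}.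
Proof. by move=> h; apply: (@filterE _ _ (ae_filter_ringOfSetsType m)). Qed.

Lemma L2_measurable u : L2 m u -> measurable_fun [set: borel X] (u : borel X -> R).
Proof. by rewrite /L2 /= inE => /andP[]; rewrite inE. Qed.

Lemma L2_sqr_integrable u : L2 m u ->
  m.-integrable [set: borel X] (EFin \o (fun x : borel X => u x * u x)).
Proof. exact: Lfun2_integrable_sqr. Qed.

Lemma sqr_integrable_L2 u : measurable_fun [set: borel X] (u : borel X -> R) ->
  m.-integrable [set: borel X] (EFin \o (fun x : borel X => u x * u x)) ->
  L2 m u.
Proof.
move=> mu iu; rewrite /L2 /= inE; apply/andP; rewrite !inE; split => //=.
rewrite /finite_norm unlock /Lnorm poweR_lty//.
move/integrableP : iu => [_]; apply: le_lt_trans.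
rewrite le_eqVlt; apply/orP; left; apply/eqP; apply: eq_integral => x _ /=.
by rewrite powR_mulrn// -normrX expr2.
Qed.

Lemma L2_le g h : L2 m g -> measurable_fun [set: borel X] (h : borel X -> R) ->
  {ae m, forall x, `|h x| <= `|g x|} -> L2 m h.
Proof.
move=> Lg mh hg; apply: sqr_integrable_L2 => //.
have mg := L2_measurable _ Lg.
apply/integrableP; split; first exact/measurable_EFinP/measurable_funM.
have /integrableP[_] := L2_sqr_integrable _ Lg.
apply: le_lt_trans; apply: ae_ge0_le_integral => //.
- exact/measurableT_comp/measurable_EFinP/measurable_funM.
- exact/measurableT_comp/measurable_EFinP/measurable_funM.
- by apply: ae_mono hg => x hgx _ /=; rewrite lee_fin !normrM ler_pM.
Qed.

Lemma L2Z c u : L2 m u -> L2 m (fun x => c * u x).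
Proof.
move=> Lu; have mu := L2_measurable _ Lu.
apply: sqr_integrable_L2; first exact: measurable_funM.
rewrite (_ : _ \o _ = fun x => ((c * c)%:E * (u x * u x)%:E)%E).
  by apply: integrableZl => //; exact: L2_sqr_integrable.
by apply/funext => x /=; rewrite -EFinM; congr EFin; ring.
Qed.

Lemma L2D u v : L2 m u -> L2 m v -> L2 m (u \+ v).
Proof.
move=> Lu Lv; have mu := L2_measurable _ Lu; have mv := L2_measurable _ Lv.
apply: sqr_integrable_L2; first exact: measurable_funD.
apply: (@le_integrable _ _ _ m [set: borel X] measurableT _
  (fun x => (2%:E * (u x * u x)%:E + 2%:E * (v x * v x)%:E)%E)) => //.
- apply/measurable_EFinP; apply: measurable_funM; exact: measurable_funD.
- move=> x _ /=; rewrite ?lee_fin.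
  rewrite (_ : `| _ | = (u x + v x) * (u x + v x)).
    by rewrite ger0_norm; [|nra]; have := sqr_ge0 (u x - v x); rewrite expr2; nra.
  by rewrite ger0_norm// -expr2 sqr_ge0.
- by apply: integrableD => //; apply: integrableZl => //; exact: L2_sqr_integrable.
Qed.

Lemma L2B u v : L2 m u -> L2 m v -> L2 m (u \- v).
Proof.
move=> Lu Lv; rewrite (_ : _ \- _ = u \+ (fun x => -1 * v x)).
  by apply: L2D => //; exact: L2Z.
by apply/funext => x /=; rewrite mulN1r.
Qed.

Lemma ip_ge0 u : 0 <= ip m u u.
Proof. by apply: Rintegral_ge0 => x _; rewrite -expr2 sqr_ge0. Qed.

Lemma ip_le u v : L2 m u -> L2 m v -> {ae m, forall x, `|u x| <= `|v x|} ->
  ip m u u <= ip m v v.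
Proof.
move=> Lu Lv uv; have mu := L2_measurable _ Lu; have mv := L2_measurable _ Lv.
have iu := L2_sqr_integrable _ Lu; have iv := L2_sqr_integrable _ Lv.
rewrite /ip /Rintegral fine_le//; [exact: integrable_fin_num..|].
apply: ae_ge0_le_integral => //.
- by move=> x _; rewrite lee_fin -expr2 sqr_ge0.
- by have /integrableP[] := iu.
- by move=> x _; rewrite lee_fin -expr2 sqr_ge0.
- by have /integrableP[] := iv.
apply: ae_mono uv => x uvx _; rewrite lee_fin.
by rewrite -[leLHS]ger0_norm -?expr2 ?sqr_ge0// -[leRHS]ger0_norm ?sqr_ge0// !normrX lerXn2r ?nnegrE.
Qed.

Lemma ip_ae u v : L2 m u -> L2 m v -> {ae m, forall x, u x = v x} ->
  ip m u u = ip m v v.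
Proof.
move=> Lu Lv uv; apply/eqP; rewrite eq_le; apply/andP; split; apply: ip_le => //.
all: by apply: ae_mono uv => x ->.
Qed.

Lemma ipZ c u : L2 m u -> ip m (fun x => c * u x) (fun x => c * u x) = c ^+ 2 * ip m u u.
Proof.
move=> Lu; rewrite /ip -RintegralZl//; last exact: L2_sqr_integrable.
by apply: eq_Rintegral => x _; ring.
Qed.

Lemma ip_parallelogram u v : L2 m u -> L2 m v ->
  ip m (u \+ v) (u \+ v) + ip m (u \- v) (u \- v) = 2 * ip m u u + 2 * ip m v v.
Proof.
move=> Lu Lv.
have LD := L2_sqr_integrable _ (L2D _ _ Lu Lv); have LB := L2_sqr_integrable _ (L2B _ _ Lu Lv).
have Iu := L2_sqr_integrable _ Lu; have Iv := L2_sqr_integrable _ Lv.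
rewrite /ip -RintegralD// -!RintegralZl// -RintegralD//.
- by apply: eq_Rintegral => x _ /=; ring.
- by rewrite (_ : _ \o _ = fun x => (2%:E * (u x * u x)%:E)%E)//; exact: integrableZl.
- by rewrite (_ : _ \o _ = fun x => (2%:E * (v x * v x)%:E)%E)//; exact: integrableZl.
Qed.

Lemma ip_eq0 u : L2 m u -> ip m u u = 0 -> {ae m, forall x, u x = 0}.
Proof.
move=> Lu u0; have iu := L2_sqr_integrable _ Lu.
have /integrableP[miu _] := iu.
have i0 : (\int[m]_x `|(EFin \o (fun x : borel X => u x * u x)%R) x| = 0)%E.
  rewrite (eq_integral (fun x => ((fun x : borel X => u x * u x) x)%:E)); last first.
    by move=> x _ /=; rewrite ger0_norm// -expr2 sqr_ge0.
  rewrite -[LHS]fineK; first by rewrite -[fine _]/(ip m u u) u0.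
  exact: integrable_fin_num.
have /ae_eq_integral_abs := i0.
move=> /(_ measurableT miu) /=.
apply: ae_mono => x /(_ I) /= [] /eqP.
by rewrite mulf_eq0 orbb => /eqP.
Qed.

(** Dominated convergence for the squares. One index [n] per tolerance is all that [weak_limit] asks
    for. *)
Lemma L2_dominated_cvg0 g (w : nat -> X -> R) (e : R) : L2 m g ->
  (forall n, L2 m (w n)) -> (forall n x, `|w n x| <= `|g x|) ->
  (forall x, w ^~ x @ \oo --> 0) -> 0 < e ->
  exists n, ip m (w n) (w n) < e.
Proof.
move=> Lg Lw wg w0 e0.
have [] := @dominated_convergence _ _ _ m [set: borel X] measurableT
  (fun n x => (w n x * w n x)%:E) (fun=> 0%E) (fun x => (g x * g x)%:E).
- by move=> n; have /integrableP[] := L2_sqr_integrable _ (Lw n).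
- exact: measurable_cst.
- apply: ae_true => x _; apply: cvg_EFin; first by near=> n.
  rewrite /= -[X in _ --> X](mulr0 (0:R)); exact: cvgM.
- exact: L2_sqr_integrable.
- by apply: ae_true => x n _; rewrite /= lee_fin !normrM -[leRHS]ger0_norm -?expr2 ?sqr_ge0 // normrX lerXn2r ?nnegrE.
move=> _ _; rewrite integral0 => /fine_cvg /= /cvgr0Pnorm_lt /(_ e e0)[N _ /(_ N (leqnn N))].
move=> h; exists N; apply: le_lt_trans h; exact: ler_norm.
Unshelve. all: end_near. Qed.

End square_integrable_functions.

(** * Calculus of the form, and weak closedness of convex sets *)

Section weak_closure.
Context {R : realType} {X : ptopologicalType}.
Context (m : {measure set (borel X) -> \bar R}).
Context (D : set (X -> R)) (a : (X -> R) -> (X -> R) -> R).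
Context (dir : dirichlet_form m D a).
Implicit Types u v w h : X -> R.

Let L2_of u : D u -> L2 m u. Proof. exact: (df_L2 dir). Qed.

Lemma dformZ_dom c u : D u -> D (fun x => c * u x).
Proof.
move=> Du; have := df_linear dir c Du (df_zero dir).
by congr D; apply/funext => x; rewrite addr0.
Qed.

Lemma dformD_dom u v : D u -> D v -> D (u \+ v).
Proof.
move=> Du Dv; have := df_linear dir 1 Du Dv.
by congr D; apply/funext => x; rewrite mul1r.
Qed.

Lemma dformB_dom u v : D u -> D v -> D (u \- v).
Proof.
move=> Du Dv; have := df_linear dir (-1) Dv Du.
by congr D; apply/funext => x; rewrite mulN1r addrC.
Qed.

Lemma dform0l w : D w -> a (fun=> 0) w = 0.
Proof.
move=> Dw; have := df_bilinear dir 1 (df_zero dir) (df_zero dir) Dw.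
rewrite (_ : (fun _ => _) = fun=> 0); last by apply/funext => x; rewrite mulr0 addr0.
by rewrite mul1r => /eqP; rewrite -subr_eq0 opprD addrA subrr sub0r oppr_eq0 => /eqP.
Qed.

Lemma dformZl c u w : D u -> D w -> a (fun x => c * u x) w = c * a u w.
Proof.
move=> Du Dw; have := df_bilinear dir c Du (df_zero dir) Dw.
rewrite dform0l// addr0 => <-; congr (a _ w).
by apply/funext => x; rewrite addr0.
Qed.

Lemma dformDl u v w : D u -> D v -> D w -> a (u \+ v) w = a u w + a v w.
Proof.
move=> Du Dv Dw; have := df_bilinear dir 1 Du Dv Dw; rewrite mul1r => <-.
by congr (a _ w); apply/funext => x; rewrite mul1r.
Qed.

Lemma dformBl u v w : D u -> D v -> D w -> a (u \- v) w = a u w - a v w.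
Proof.
move=> Du Dv Dw; have := df_bilinear dir (-1) Dv Du Dw.
rewrite mulN1r addrC => <-.
by congr (a _ w); apply/funext => x; rewrite mulN1r addrC.
Qed.

Lemma dformZr c u w : D u -> D w -> a w (fun x => c * u x) = c * a w u.
Proof.
move=> Du Dw; have Dcu := dformZ_dom c _ Du.
by rewrite (df_sym dir Dw Dcu) dformZl// (df_sym dir Dw Du).
Qed.

Lemma dformDr u v w : D u -> D v -> D w -> a w (u \+ v) = a w u + a w v.
Proof.
move=> Du Dv Dw; have Duv := dformD_dom _ _ Du Dv.
by rewrite (df_sym dir Dw Duv) dformDl// (df_sym dir Dw Du) (df_sym dir Dw Dv).
Qed.

Lemma dformBr u v w : D u -> D v -> D w -> a w (u \- v) = a w u - a w v.
Proof.
move=> Du Dv Dw; have Duv := dformB_dom _ _ Du Dv.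
by rewrite (df_sym dir Dw Duv) dformBl// (df_sym dir Dw Du) (df_sym dir Dw Dv).
Qed.

Lemma form_ae u v : D u -> D v -> {ae m, forall x, u x = v x} -> a u u = a v v.
Proof.
move=> Du Dv uv; rewrite (df_ae dir Du Dv Du uv) (df_sym dir Dv Du).
exact: (df_ae dir Du Dv Dv uv).
Qed.

Lemma dformZZ c u : D u -> a (fun x => c * u x) (fun x => c * u x) = c ^+ 2 * a u u.
Proof.
move=> Du; have Dcu := dformZ_dom c _ Du.
by rewrite dformZl// dformZr// mulrA expr2.
Qed.

Lemma form_parallelogram u v : D u -> D v ->
  a (u \+ v) (u \+ v) + a (u \- v) (u \- v) = 2 * a u u + 2 * a v v.
Proof.
move=> Du Dv; have Dp := dformD_dom _ _ Du Dv; have Dm := dformB_dom _ _ Du Dv.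
rewrite dformDl// dformBl// !(dformDr u v)// !(dformBr u v)//; ring.
Qed.

(* Polarization of [0 <= a (t u - v, t u - v)]. *)
Lemma form_young t u v : 0 < t -> D u -> D v ->
  a (u \+ v) (u \+ v) <= (1 + t) * a u u + (1 + t^-1) * a v v.
Proof.
move=> t0 Du Dv; have Dtu := dformZ_dom t _ Du.
have := df_ge0 dir (dformB_dom _ _ Dtu Dv).
have Dp := dformD_dom _ _ Du Dv; have Dm := dformB_dom _ _ Dtu Dv.
rewrite dformBl// dformZl// !(dformBr _ v)// !(dformZr t u)// dformDl// !(dformDr u v)//.
rewrite (df_sym dir Dv Du) => h.
have : 0 <= t^-1 * (t * (t * a u u - a u v) - (t * a u v - a v v)).
  by apply: mulr_ge0 h; rewrite invr_ge0 ltW.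
suff -> : t^-1 * (t * (t * a u u - a u v) - (t * a u v - a v v)) =
  t * a u u - 2 * a u v + t^-1 * a v v by lra.
by field; rewrite gt_eqF.
Qed.

(** The square of the intrinsic norm, for which the parallelogram law holds without square roots. *)
Definition energy u := a u u + ip m u u.

Lemma form_le_energy u : a u u <= energy u.
Proof. by rewrite lerDl ip_ge0. Qed.

Lemma ip_le_energy u : D u -> ip m u u <= energy u.
Proof. by move=> Du; rewrite lerDr (df_ge0 dir). Qed.

Lemma energy_ge0 u : D u -> 0 <= energy u.
Proof. by move=> Du; rewrite addr_ge0 ?ip_ge0 ?(df_ge0 dir). Qed.

Lemma inormE u : inorm m a u = Num.sqrt (energy u). Proof. by []. Qed.

Lemma energy_ae u v : D u -> D v -> {ae m, forall x, u x = v x} ->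
  energy u = energy v.
Proof.
by move=> Du Dv uv; rewrite /energy (form_ae _ v)// (ip_ae _ _ v)//; exact: L2_of.
Qed.

Lemma energyZ c u : D u -> energy (fun x => c * u x) = c ^+ 2 * energy u.
Proof. by move=> Du; rewrite /energy dformZZ// ipZ ?mulrDr//; exact: L2_of. Qed.

Lemma energy_parallelogram u v : D u -> D v ->
  energy (u \+ v) + energy (u \- v) = 2 * energy u + 2 * energy v.
Proof.
move=> Du Dv; have := form_parallelogram _ _ Du Dv.
have := ip_parallelogram m _ _ (L2_of _ Du) (L2_of _ Dv).
rewrite /energy; lra.
Qed.

(** The parallelogram law with one square dropped; it stands in for the triangle inequality. *)
Lemma energyD_le u v : D u -> D v -> energy (u \+ v) <= 2 * energy u + 2 * energy v.
Proof.
move=> Du Dv; rewrite -energy_parallelogram// lerDl energy_ge0//.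
exact: dformB_dom.
Qed.

Lemma energyB_le u v : D u -> D v -> energy (u \- v) <= 2 * energy u + 2 * energy v.
Proof.
move=> Du Dv; rewrite -energy_parallelogram// lerDr energy_ge0//.
exact: dformD_dom.
Qed.

Definition midpoint_convex (P : set (X -> R)) :=
  forall u v, P u -> P v -> P (fun x => 2^-1 * (u \+ v) x).

(** For [P] inside [D], functions equal m-a.e. are at energy distance 0, so closedness also makes
    [P] saturated within [D]. *)
Definition energy_closed (P : set (X -> R)) :=
  forall h, D h -> (forall e : R, 0 < e -> exists2 w, P w & energy (h \- w) < e) ->
  P h.

Lemma ip_midpoint_lt h u v e : L2 m h -> L2 m u -> L2 m v ->
  ip m (h \- u) (h \- u) < e -> ip m (h \- v) (h \- v) < e ->
  ip m (h \- (fun x => 2^-1 * (u \+ v) x)) (h \- (fun x => 2^-1 * (u \+ v) x)) < e.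
Proof.
move=> Lh Lu Lv hu hv.
have Lhu := L2B m _ _ Lh Lu; have Lhv := L2B m _ _ Lh Lv.
have -> : h \- (fun x => 2^-1 * (u \+ v) x) = fun x => 2^-1 * ((h \- u) \+ (h \- v)) x.
  by apply/funext => x /=; field.
rewrite ipZ; last exact: L2D.
have := ip_parallelogram m _ _ Lhu Lhv.
have := ip_ge0 m ((h \- u) \- (h \- v)).
rewrite expr2; lra.
Qed.

(* Banach-Saks in disguise: the near-minimizers of the energy among the elements
   of P that are close to h in L^2 form a Cauchy sequence, by the parallelogram
   law. *)
Lemma weak_limit (P : set (X -> R)) h (B : R) :
  P `<=` D -> midpoint_convex P -> energy_closed P -> L2 m h ->
  (forall e : R, 0 < e ->
     exists w, [/\ P w, energy w <= B & ip m (h \- w) (h \- w) < e]) ->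
  P h.
Proof.
move=> PD Pmid Pcl Lh happ.
(* The supremum of [S] is the limit, as the L^2 radius [d] shrinks to 0, of the infimal energy over
   the elements of [P] within that radius of [h]. *)
pose S : set R := [set s | exists2 d : R, 0 < d & forall w, P w ->
  ip m (h \- w) (h \- w) < d -> s <= energy w].
have S0 : S 0 by exists 1 => // w Pw _; exact/energy_ge0/PD.
have SB : ubound S B.
  move=> s [d d0 sd]; have [w [Pw wB wd]] := happ d d0.
  exact: (le_trans (sd w Pw wd) wB).
have supS : has_sup S by split; [exists 0|exists B].
pose s := sup S.
have low (n : nat) : exists d : R, 0 < d /\ forall w, P w ->
    ip m (h \- w) (h \- w) < d -> s - n.+1%:R^-1 <= energy w.
  have [] := @sup_adherent _ S n.+1%:R^-1 _ supS; first by rewrite invr_gt0.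
  move=> r [d d0 rd] /ltW sr; exists d; split => // w Pw wd.
  exact: (le_trans sr (rd w Pw wd)).
have /choice[d dP] := low.
(* Nonincreasing radii below both [d n] and 1 / (n + 1), so that the lower bound at stage N serves
   all later stages. *)
pose dm := fix dm (n : nat) : R := match n with
  | 0%N => Num.min 1 (d 0%N) | n'.+1 => Num.min (dm n') (Num.min n.+1%:R^-1 (d n)) end.
have dm0 n : 0 < dm n.
  elim: n => [|n IH] /=; first by rewrite lt_min ltr01 (dP 0%N).1.
  by rewrite !lt_min IH (dP n.+1).1 invr_gt0 ltr0n.
have dmd n : dm n <= d n.
  by case: n => [|n] /=; rewrite !ge_min lexx ?orbT.
have dmn n : dm n <= n.+1%:R^-1.
  by case: n => [|n] /=; rewrite !ge_min ?invr1 lexx ?orbT.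
have dm_mono i j : (i <= j)%N -> dm j <= dm i.
  elim: j => [|j IH]; first by rewrite leqn0 => /eqP ->.
  rewrite leq_eqVlt => /predU1P[-> //|]; rewrite ltnS => /IH.
  by apply: le_trans; rewrite /= ge_min lexx.
have up (n : nat) : exists w, [/\ P w, energy w < s + n.+1%:R^-1 &
    ip m (h \- w) (h \- w) < dm n].
  (* Without such a near-minimizer, s + 1 / (n + 1) would itself belong to [S]. *)
  apply: contrapT => nex.
  have : S (s + n.+1%:R^-1).
    exists (dm n) => // w Pw wd; rewrite leNgt; apply/negP => ws.
    by apply: nex; exists w.
  move/(ub_le_sup supS.2); rewrite -/s; apply/negP.
  by rewrite -ltNge ltrDl invr_gt0.
have /choice[w wP] := up.
have Pw n : P (w n) by have [] := wP n.
have Dw n : D (w n) by exact: PD.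
(* The midpoint of [w i] and [w j] is again close to [h], so its energy is at least s - 1 / (N + 1),
   while those of [w i] and [w j] are below s + 1 / (N + 1). The parallelogram law leaves 4 + 4
   multiples of 1 / (N + 1). *)
have cau N i j : (N <= i)%N -> (N <= j)%N ->
    energy (w i \- w j) <= 8 * N.+1%:R^-1.
  move=> Ni Nj; have [_ ei hi] := wP i; have [_ ej hj] := wP j.
  have inv_le k : (N <= k)%N -> (k.+1%:R^-1 : R) <= N.+1%:R^-1.
    by move=> Nk; rewrite lef_pV2 ?posrE// ler_nat.
  have hdN k : (N <= k)%N -> ip m (h \- w k) (h \- w k) < d N.
    move=> Nk; have [_ _] := wP k; move/lt_le_trans; apply.
    by rewrite (le_trans (dm_mono _ _ Nk)).
  have := (dP N).2 _ (Pmid _ _ (Pw i) (Pw j)).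
  move=> /(_ (ip_midpoint_lt _ _ _ _ Lh (L2_of _ (Dw i)) (L2_of _ (Dw j)) (hdN i Ni) (hdN j Nj))).
  rewrite energyZ; last exact: dformD_dom.
  have := energy_parallelogram _ _ (Dw i) (Dw j).
  move: ei ej (inv_le i Ni) (inv_le j Nj) => {dP wP hdN inv_le}.
  move: (i.+1%:R^-1) (j.+1%:R^-1) (N.+1%:R^-1) => x y z.
  rewrite expr2; clearbody s; lra.
have small (e : R) : 0 < e -> exists N : nat, 8 * N.+1%:R^-1 < e.
  move=> e0; have [N _ /(_ N (leqnn N))] := near_infty_natSinv_lt (PosNum (divr_gt0 e0 (ltr0n _ 8))).
  by move=> h'; exists N; rewrite mulrC -ltr_pdivlMr.
have cauchy (e : R) : 0 < e -> exists N : nat, forall i j,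
    (N <= i)%N -> (N <= j)%N -> inorm m a (w i \- w j) < e.
  move=> e0; have [N NP] := small (e ^+ 2) (exprn_gt0 _ e0).
  exists N => i j Ni Nj; rewrite inormE -[ltRHS]gtr0_norm// -sqrtr_sqr.
  rewrite ltr_sqrt ?exprn_gt0//; exact: (le_lt_trans (cau _ _ _ Ni Nj) NP).
have [v Dv wv] := df_complete dir Dw cauchy.
have near_v (e : R) : 0 < e -> exists N : nat, forall n, (N <= n)%N -> energy (w n \- v) < e.
  move=> e0; have se0 : 0 < Num.sqrt e by rewrite sqrtr_gt0.
  have /cvgr0Pnorm_lt/(_ _ se0)[N _ NP] := wv.
  exists N => n Nn; have := NP n Nn; rewrite /= inormE ger0_norm ?sqrtr_ge0//.
  by rewrite ltr_sqrt.
(* The sequence tends to [h] in L^2 and to [v] in the intrinsic norm, so the two limits agree. *)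
have hv0 : ip m (h \- v) (h \- v) = 0.
  apply/eqP; rewrite eq_le ip_ge0 andbT; apply/ler_addgt0Pl => e e0; rewrite addr0.
  have [N NP] := near_v (e / 4) (divr_gt0 e0 (ltr0n _ 4)).
  have [M MP] := small e e0.
  pose n := maxn N M.
  have wn := NP n (leq_maxl _ _).
  have [_ _ hn] := wP n; have := le_trans (ltW hn) (dmn n).
  have inv_le : (n.+1%:R^-1 : R) <= M.+1%:R^-1.
    by rewrite lef_pV2 ?posrE// ler_nat ltnS leq_maxr.
  have LhW := L2B m _ _ Lh (L2_of _ (Dw n)); have LwV := L2B m _ _ (L2_of _ (Dw n)) (L2_of _ Dv).
  have := ip_parallelogram m _ _ LhW LwV.
  have -> : (h \- w n) \+ (w n \- v) = h \- v by apply/funext => x /=; ring.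
  have := ip_ge0 m ((h \- w n) \- (w n \- v)).
  have := ip_le_energy _ (dformB_dom _ _ (Dw n) Dv).
  move: inv_le MP wn.
  move: (n.+1%:R^-1) (M.+1%:R^-1) (energy (w n \- v)) => x y z; clearbody n.
  lra.
have hv : {ae m, forall x, v x = h x}.
  have := ip_eq0 m _ (L2B m _ _ Lh (L2_of _ Dv)) hv0.
  by apply: ae_mono => x /= /eqP; rewrite subr_eq0 => /eqP.
have Dh : D h := df_saturated dir Dv Lh hv.
apply: Pcl => // e e0; have [N NP] := near_v e e0.
exists (w N) => //; apply: le_lt_trans (NP N (leqnn N)).
(* [h] is only known to equal [v] a.e.; the factor -1 reverses the difference. *)
rewrite (energy_ae _ (fun x => -1 * (w N \- v) x)).
- rewrite energyZ; first by rewrite expr2 mulrNN !mul1r.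
  exact: dformB_dom.
- exact: dformB_dom.
- exact/dformZ_dom/dformB_dom.
by apply: ae_mono hv => x /= ->; ring.
Qed.

Lemma dom_midpoint_convex : midpoint_convex D.
Proof. by move=> u v Du Dv; apply: dformZ_dom; exact: dformD_dom. Qed.

(** That these sets are convex and closed amounts, through [weak_limit], to lower semicontinuity of
    the form along L^2-convergent sequences of bounded energy. *)
Definition form_ball (C : R) : set (X -> R) := [set w | D w /\ a w w <= C].

Lemma form_ball_convex C : midpoint_convex (form_ball C).
Proof.
move=> u v [Du uC] [Dv vC]; split; first exact: dom_midpoint_convex.
rewrite dformZZ; last exact: dformD_dom.
have := form_parallelogram _ _ Du Dv.
have := df_ge0 dir (dformB_dom _ _ Du Dv); rewrite expr2; lra.
Qed.

Lemma form_ball_closed C : energy_closed (form_ball C).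
Proof.
move=> h Dh hap; split => //.
have [C0|C0] := leP 0 C; last first.
  have [w [Dw wC] _] := hap 1 ltr01; have := df_ge0 dir Dw; lra.
apply/ler_addgt0Pr => e e0.
(* In Young's inequality for h = w + (h - w), this [t] keeps t * a w w at most e / 2, and the radius
   below leaves e / 2 for the other term. The summand 1 keeps the denominator nonzero when C = 0. *)
pose t := e / (2 * (C + 1)).
have t0 : 0 < t by rewrite divr_gt0// mulr_gt0//; lra.
have q0 : 0 < e / (2 * (1 + t^-1)).
  by rewrite divr_gt0// mulr_gt0// addr_gt0// invr_gt0.
have [w [Dw wC] hw] := hap _ q0.
have Dhw := dformB_dom _ _ Dh Dw.
have := form_young t _ _ t0 Dw Dhw.
have -> : w \+ (h \- w) = h by apply/funext => x /=; ring.
move=> /le_trans; apply.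
have tC : t * C <= e / 2.
  rewrite /t [X in X <= _](_ : _ = e / 2 * (C / (C + 1))); last by field; lra.
  by rewrite ler_piMr ?divr_ge0 ?ltW// ltr_pdivrMr; lra.
have := le_lt_trans (form_le_energy _) hw => ha.
have : (1 + t^-1) * a (h \- w) (h \- w) <= e / 2.
  have s0 : 0 < 1 + t^-1 by rewrite addr_gt0// invr_gt0.
  rewrite mulrC -ler_pdivlMr//; apply: (le_trans (ltW ha)).
  by rewrite le_eqVlt; apply/orP; left; apply/eqP; field; rewrite !gt_eqF//; lra.
have : (1 + t) * a w w <= (1 + t) * C by rewrite ler_pM2l//; lra.
lra.
Qed.

End weak_closure.

(** * Truncations, positive parts and functions of small capacity *)

Definition pospart {R : realType} {X : Type} (u : X -> R) : X -> R :=
  fun x => Num.max (u x) 0.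

Definition trunc {R : realType} {X : Type} (c : R) (u : X -> R) : X -> R :=
  fun x => Num.min c (Num.max (u x) 0).

Section lattice.
Context {R : realType} {X : ptopologicalType}.
Context (m : {measure set (borel X) -> \bar R}).
Context (D : set (X -> R)) (a : (X -> R) -> (X -> R) -> R).
Context (dir : dirichlet_form m D a).
Implicit Types u v w h : X -> R.
Let L2_of u : D u -> L2 m u. Proof. exact: (df_L2 dir). Qed.

Local Notation energy := (energy m a).

(** Homogeneity: truncating at [c] is truncating u / c at 1, where the Markov property applies, and
    scaling back. *)
Lemma trunc_form c u : 0 < c -> D u ->
  D (trunc c u) /\ a (trunc c u) (trunc c u) <= a u u.
Proof.
move=> c0 Du; have c1 : 0 < c^-1 by rewrite invr_gt0.
have [Dv va] := df_markov dir (dformZ_dom _ _ _ dir c^-1 _ Du).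
set v := (fun x => _) in Dv va.
have -> : trunc c u = fun x => c * v x.
  apply/funext => x; rewrite /trunc /v.
  rewrite minr_pMr ?ltW// mulr1 maxr_pMr ?ltW// mulr0 mulrA mulfV ?gt_eqF//.
  by rewrite mul1r.
split; first exact: (dformZ_dom _ _ _ dir).
rewrite (dformZZ _ _ _ dir)//; move: va.
rewrite (dformZZ _ _ _ dir)// exprVn => va.
by rewrite -ler_pdivlMl ?exprn_gt0.
Qed.

Lemma measurable_pospart u : measurable_fun [set: borel X] (u : borel X -> R) ->
  measurable_fun [set: borel X] (pospart u : borel X -> R).
Proof. by move=> mu; apply: measurable_maxr => //; exact: measurable_cst. Qed.

Lemma le_norm_pospart u x : `|pospart u x| <= `|u x|.
Proof.
by rewrite /pospart; case: (leP (u x) 0) => u0; rewrite ?normr0.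
Qed.

Lemma L2_pospart u : L2 m u -> L2 m (pospart u).
Proof.
move=> Lu; apply: (L2_le m u) => //; first by apply: measurable_pospart; apply: (L2_measurable m).
by apply: ae_true => x; exact: le_norm_pospart.
Qed.

(** The form of [weak_limit] suited to pointwise limits: dominated convergence supplies the L^2
    convergence. *)
Lemma weak_limit_dominated (P : set (X -> R)) h g (w : nat -> X -> R) (B : R) :
  P `<=` D -> midpoint_convex P -> energy_closed m D a P -> L2 m h -> L2 m g ->
  (forall n, P (w n)) -> (forall n, energy (w n) <= B) ->
  (forall n x, `|h x - w n x| <= `|g x|) ->
  (forall x, (fun n => h x - w n x) @ \oo --> 0) ->
  P h.
Proof.
move=> PD Pmid Pcl Lh Lg Pw wB hg hw.
apply: (weak_limit m D a dir P h B) => // e e0.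
have [n nP] := L2_dominated_cvg0 m g (fun n => h \- w n) e Lg
  (fun n => L2B m _ _ Lh (L2_of _ (PD _ (Pw n)))) hg hw e0.
by exists (w n); split.
Qed.

Lemma trunc_pospart_cvg u x :
  (fun n : nat => pospart u x - trunc n.+1%:R u x) @ \oo --> 0.
Proof.
apply: cvg_near_cst; have := nbhs_infty_ger (u x).
apply: filterS => n un; rewrite /pospart /trunc; apply/eqP; rewrite subr_eq0.
by rewrite eq_sym; apply/eqP/min_idPr; rewrite ge_max ler0n (le_trans un)// ler_nat.
Qed.

Lemma pospart_trunc_le c u x : 0 <= c -> `|pospart u x - trunc c u x| <= `|u x|.
Proof.
move=> c0; rewrite /pospart /trunc; case: (leP (u x) 0) => u0.
  by rewrite (min_idPr c0) subrr normr0.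
case: (leP c (u x)) => cu; last by rewrite subrr normr0.
by rewrite !ger0_norm//; lra.
Qed.

Lemma trunc_le_pospart c u x : 0 <= c -> `|trunc c u x| <= `|u x|.
Proof.
move=> c0; rewrite /trunc; case: (leP (u x) 0) => u0.
  by rewrite (min_idPr c0) normr0.
by case: (leP c (u x)) => cu; rewrite ?ger0_norm//; lra.
Qed.

Lemma energy_trunc c u : 0 < c -> D u -> energy (trunc c u) <= energy u.
Proof.
move=> c0 Du; have [Dt ta] := trunc_form c u c0 Du.
apply: lerD => //; apply: ip_le; [exact: L2_of..|].
by apply: ae_true => x; apply: trunc_le_pospart; exact: ltW.
Qed.

(** The truncations at heights n + 1 lie in one form ball and increase to the positive part. *)
Lemma pospart_form u : D u ->
  D (pospart u) /\ a (pospart u) (pospart u) <= a u u.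
Proof.
move=> Du; pose P := form_ball D a (a u u).
suff : P (pospart u) by [].
apply: (@weak_limit_dominated P _ u (fun n => trunc n.+1%:R u) (energy u)) => //.
- by move=> w [].
- exact: (form_ball_convex m).
- exact: form_ball_closed.
- exact/L2_pospart/L2_of.
- exact: L2_of.
- by move=> n; exact: trunc_form.
- by move=> n; exact: energy_trunc.
- by move=> n x; exact: pospart_trunc_le.
- by move=> x; exact: trunc_pospart_cvg.
Qed.

Lemma pospart_dom u : D u -> D (pospart u).
Proof. by case/pospart_form. Qed.

Lemma trunc_dom c u : 0 < c -> D u -> D (trunc c u).
Proof. by move=> c0 /(trunc_form _ _ c0)[]. Qed.

Lemma energy_pospart u : D u -> energy (pospart u) <= energy u.
Proof.
move=> Du; have [Dt ta] := pospart_form u Du.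
apply: lerD => //; apply: ip_le; [exact: L2_of..|].
by apply: ae_true => x; exact: le_norm_pospart.
Qed.

(* With e >= 1 a.e. off F and w <= M, this subtracts w off F while staying close
   to w in L^2. *)
Definition shave (M : R) w e : X -> R := pospart (w \- (fun x => M * e x)).

Lemma shave_dom M w e : D w -> D e -> D (shave M w e).
Proof.
move=> Dw De; apply/pospart_dom/(dformB_dom _ _ _ dir) => //.
exact: (dformZ_dom _ _ _ dir).
Qed.

Lemma energy_shave M w e : D w -> D e ->
  energy (shave M w e) <= 2 * energy w + 2 * (M ^+ 2 * energy e).
Proof.
move=> Dw De; have DMe := dformZ_dom _ _ _ dir M _ De.
apply: le_trans (energy_pospart _ (dformB_dom _ _ _ dir _ _ Dw DMe)) _.
by apply: le_trans (energyB_le _ _ _ dir _ _ Dw DMe) _; rewrite (energyZ _ _ _ dir).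
Qed.

(** The difference is the minimum of w and M e, which is at most |M e| in absolute value because w
    >= 0. *)
Lemma ip_shave M w e : 0 <= M -> D w -> D e -> (forall x, 0 <= w x) ->
  ip m (w \- shave M w e) (w \- shave M w e) <= M ^+ 2 * energy e.
Proof.
move=> M0 Dw De w0; have DMe := dformZ_dom _ _ _ dir M _ De.
have Le := L2_of _ De.
apply: (@le_trans _ _ (ip m (fun x => M * e x) (fun x => M * e x))).
  apply: ip_le; [|exact: L2_of|].
    by apply: L2B; apply: L2_of => //; exact: shave_dom.
  apply: ae_true => x; rewrite /shave /pospart /=.
  case: (leP (w x - M * e x) 0) => h; last by rewrite (_ : _ - _ = M * e x)//; ring.
  by rewrite subr0 ger0_norm// (le_trans _ (ler_norm _))//; lra.
rewrite ipZ// ler_wpM2l ?sqr_ge0//; exact: (ip_le_energy _ _ _ dir).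
Qed.

(** For closed [F], such an [e] witnesses that the complement of [F] has capacity less than [d].
    Nonnegativity everywhere, not just a.e., makes later pointwise estimates direct. *)
Definition capacity_exceptional (F : set X) (d : R) e :=
  [/\ D e, forall x, 0 <= e x, {ae m, forall x, ~ F x -> 1 <= e x} & energy e < d].

Lemma quasi_continuous_closed_set u (d : R) : quasi_continuous m D a u -> 0 < d ->
  exists F e, [/\ closed F, {within F, continuous u} & capacity_exceptional F d e].
Proof.
move=> [F [Fcl _ capF Fu]] d0.
have [k kd] : exists k, (cap m D a (~` F k) < d%:E)%E.
  have /capF[N _ NP] : nbhs 0%E [set y | (y < d%:E)%E].
    by apply: open_nbhs_nbhs; split; [exact: open_ereal_lt_ereal|rewrite /= lte_fin].
  by exists N; exact: (NP N (leqnn N)).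
have [_ [G [oG FG] <-]] := ereal_inf_lt kd.
move=> /ereal_inf_lt[_ [e [De e1] <-]]; rewrite lte_fin => ed.
exists (F k), (pospart e); split=> //; split.
- exact: pospart_dom.
- by move=> x; rewrite /pospart le_max lexx orbT.
- apply: ae_mono e1 => x ex /FG /ex h; by rewrite /pospart le_max h.
- exact: le_lt_trans (energy_pospart _ De) ed.
Qed.

End lattice.

(** * Vanishing off the support *)

Section support.
Context {R : realType} {X : ptopologicalType}.
Context (m : {measure set (borel X) -> \bar R}).
Context (X_hausdorff : hausdorff_space X).
Context (m_radon : radon_measure m).
Implicit Types u : X -> R.

Lemma open_borel (G : set X) : open G -> measurable (G : set (borel X)).
Proof. exact: sub_gen_smallest. Qed.

Lemma closed_supp u : closed (supp m u).
Proof. by apply: open_closedC; apply: bigcup_open => G []. Qed.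

(** A finite subcover by open sets on which [u] vanishes a.e. leaves finitely many exceptional null
    sets. *)
Lemma ae_eq0_compact u (K : set X) : compact K -> K `<=` ~` supp m u ->
  {ae m, forall x, K x -> u x = 0}.
Proof.
rewrite compact_cover => cK Ku.
have GP x : exists G : set X, K x -> [/\ open G, G x & {ae m, forall x, G x -> u x = 0}].
  have [Kx|nKx] := pselect (K x); last by exists setT.
  have := Ku x Kx; rewrite /supp setCK => -[G [oG Gu] Gx]; by exists G.
have /choice[G {}GP] := GP.
have [||D DK KD] := cK X K G.
- by move=> i /GP[].
- by move=> x Kx; exists x => //; have [] := GP x Kx.
have : almost_everywhere m (\bigcap_(i in [set` D]) [set x | G i x -> u x = 0]).
  apply: (@filter_bigI _ _ _ _ _ (ae_filter_ringOfSetsType m)) => i iD.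
  by have [] := GP i (set_mem (DK i iD)).
by apply: ae_mono => x xG /KD[i /= iD /(xG i iD)].
Qed.

(** Chebyshev's inequality for u^2; finiteness permits the cancellation of measures in
    [ae_eq0_off_supp]. *)
Lemma level_set_finite u (c : R) : L2 m u -> 0 < c ->
  (m [set x | (c <= `|u x|)%R] < +oo)%E.
Proof.
move=> Lu c0; have iu := L2_sqr_integrable m u Lu.
have /integrableP[mu2 fu2] := iu.
have c2 : 0 < c ^+ 2 by rewrite exprn_gt0.
have := @le_integral_comp_abse _ _ R m [set: borel X] measurableT _ (c ^+ 2) id
  (@measurable_id _ _ _) (fun r r0 => r0) (fun x y _ _ xy => xy) mu2 c2.
rewrite setTI => /le_lt_trans/(_ fu2).
rewrite (_ : [set x | _] = [set x : borel X | c <= `|u x|]); last first.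
  by apply/seteqP; split => x /=;
    rewrite lee_fin normrM -expr2 ler_pXn2r ?nnegrE ?normr_ge0 ?(ltW c0).
move=> h; rewrite ltey; apply/negP => /eqP h'; move: h; rewrite h'.
by rewrite gt0_muley ?lte_fin// ltxx.
Qed.

(* X need not be second countable, so the union of the open m-null sets is
   handled through the inner regularity of m. *)
Lemma ae_eq0_off_supp u : L2 m u -> {ae m, forall x, ~ supp m u x -> u x = 0}.
Proof.
move=> Lu; have mu := L2_measurable m u Lu.
have [_ outer inner] := m_radon.
have oO : open (~` supp m u) by apply: closed_openC; exact: closed_supp.
have mO := open_borel _ oO.
have mlevel (n : nat) : measurable [set x : borel X | n.+1%:R^-1 <= `|u x|].
  rewrite -[X in measurable X]setTI.
  have : measurable_fun [set: borel X] (fun x : borel X => `|u x|).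
    exact: measurableT_comp.
  move=> /(_ measurableT `[n.+1%:R^-1, +oo[%classic (measurable_itv _)).
  by congr measurable; apply/seteqP; split => x /=; rewrite in_itv /= andbT.
pose A (n : nat) : set (borel X) := (~` supp m u) `&` [set x | n.+1%:R^-1 <= `|u x|].
have mA n : measurable (A n) by apply: measurableI.
have A0 n : m (A n) = 0%E.
  have fA : (m (A n) < +oo)%E.
    apply: (@le_lt_trans _ _ (m [set x | n.+1%:R^-1 <= `|u x|])).
      by apply: le_measure; [exact: mem_set|exact: mem_set|move=> x []].
    by apply: level_set_finite => //; rewrite invr_gt0.
  have fAn : m (A n) \is a fin_num by rewrite ge0_fin_numE.
  apply/eqP; rewrite eq_le measure_ge0 andbT.
  apply/lee_addgt0Pr => e e0; rewrite add0e.
  have : (ereal_inf [set m G | G in [set G : set X | open G /\ A n `<=` G]] < m (A n) + e%:E)%E.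
    by rewrite -outer// lteDl// lte_fin.
  (* [G] exceeds [A n] by less than [e] in measure. A compact [K] in [G] off the support meets [A n]
     in a null set, so [m K] is at most the measure of [G] minus [A n]; inner regularity passes this
     bound to the part of [G] off the support, which contains [A n]. *)
  move=> /ereal_inf_lt[_ [G [oG AG] <-]] GA.
  have oGO : open (G `&` ~` supp m u) by apply: openI.
  have mG := open_borel _ oG; have mGO := open_borel _ oGO.
  apply: (@le_trans _ _ (m (G `&` ~` supp m u))).
    apply: le_measure; [exact: mem_set|exact: mem_set|move=> x Ax; split]; [exact: AG|by case: Ax].
  rewrite inner//; apply: ge_ereal_sup => _ [K [cK KG] <-].
  have mK : measurable (K : set (borel X)).
    rewrite -(setCK K); apply: measurableC; apply: open_borel.
    by apply: closed_openC; exact: compact_closed.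
  have KA0 : m (K `&` A n) = 0%E.
    apply: measure_negligible; first exact: measurableI.
    apply: negligibleS (ae_eq0_compact u K cK (fun x Kx => (KG x Kx).2)).
    move=> x /= [Kx [_ ux]] /(_ Kx) ux0.
    by move: ux; rewrite /= ux0 normr0 leNgt invr_gt0 ltr0Sn.
  have -> : m K = m (K `\` A n).
    by rewrite (measureDI m mK (mA n)) -[RHS]adde0; congr (_ + _)%E.
  apply: (@le_trans _ _ (m (G `\` A n))).
    by apply: le_measure; [exact/mem_set/measurableD|exact/mem_set/measurableD|move=> x [/KG[]]].
  move: GA; rewrite (measureDI m mG (mA n)) (setIidr AG) addeC.
  by rewrite lteD2lE// => /ltW.
have : m.-negligible (\bigcup_n A n).
  by apply: negligible_bigcup => n; exists (A n); split.
apply: negligibleS => x /= /not_implyP[ux /eqP u0].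
have u0' : 0 < `|u x| by rewrite normr_gt0.
have [n _ nP] := near_infty_natSinv_lt (PosNum u0').
exists n => //; split => //=; exact/ltW/(nP n (leqnn n)).
Qed.

End support.

(** * The equation off the contact set *)

Section obstacle_equation.
Context {R : realType} {X : ptopologicalType}.
Context (X_hausdorff : hausdorff_space X).
Context (m : {measure set (borel X) -> \bar R}).
Context (m_radon : radon_measure m).
Context (D : set (X -> R)) (a : (X -> R) -> (X -> R) -> R).
Context (dir : dirichlet_form m D a).
Context (psi : X -> R) (f : (X -> R) -> R) (u : X -> R).
Context (psi_qc : quasi_continuous m D a psi).
Context (f_dual : in_dual m D a f).
Context (u_solution : obstacle_solution m D a psi f u).
Context (u_qc : quasi_continuous m D a u).

Local Notation energy := (energy m a).
Let L2_of w : D w -> L2 m w. Proof. exact: (df_L2 dir). Qed.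
Let Du : D u. Proof. by have [[]] := u_solution. Qed.

(** The test functions for which the equation holds. They form a closed subspace of D[a], so the
    equation passes to weak limits. *)
Let P : set (X -> R) := [set w | D w /\ a u w = f w].

Let fD v w : D v -> D w -> f (v \+ w) = f v + f w.
Proof.
move=> Dv Dw; have [/(_ 1 v w Dv Dw) + _] := f_dual; rewrite mul1r => <-.
by congr f; apply/funext => x; rewrite mul1r.
Qed.

Let fZ c v : D v -> f (fun x => c * v x) = c * f v.
Proof.
move=> Dv; have [lin _] := f_dual.
have f0 : f (fun=> 0) = 0.
  have := lin (-1) _ _ Dv Dv; rewrite mulN1r addNr.
  by apply: etrans; congr f; apply/funext => x; rewrite mulN1r addNr.
have := lin c _ _ Dv (df_zero dir); rewrite f0 addr0 => <-.
by congr f; apply/funext => x; rewrite addr0.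
Qed.

Let fB v w : D v -> D w -> f (v \- w) = f v - f w.
Proof.
move=> Dv Dw; rewrite -(mulN1r (f w)) -fZ// -fD//; last exact: (dformZ_dom _ _ _ dir).
by congr f; apply/funext => x /=; rewrite mulN1r.
Qed.

Let P_convex : midpoint_convex P.
Proof.
move=> v w [Dv vP] [Dw wP]; have Dvw := dformD_dom _ _ _ dir _ _ Dv Dw.
split; first exact: (dformZ_dom _ _ _ dir).
by rewrite (dformZr _ _ _ dir)// fZ// fD// (dformDr _ _ _ dir)// vP wP.
Qed.

Let P_closed : energy_closed m D a P.
Proof.
move=> h Dh hap; split => //; have [_ [C fC]] := f_dual.
have au0 := df_ge0 dir Du.
apply/eqP; rewrite -subr_eq0 -normr_le0; apply/ler_addgt0Pr => eta eta0; rewrite add0r.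
pose t := eta / (2 * (a u u + 1)).
have t0 : 0 < t by rewrite divr_gt0// mulr_gt0//; lra.
have tau : t * a u u <= eta / 2.
  rewrite /t [X in X <= _](_ : _ = eta / 2 * (a u u / (a u u + 1))); last by field; lra.
  by rewrite ler_piMr ?divr_ge0 ?ltW// ltr_pdivrMr; lra.
pose s := eta / (2 * (`|C| + 1)).
have C1 : 0 < `|C| + 1 by have := normr_ge0 C; lra.
have s0 : 0 < s by rewrite divr_gt0// mulr_gt0.
have sC : `|C| * s <= eta / 2.
  rewrite /s [X in X <= _](_ : _ = eta / 2 * (`|C| / (`|C| + 1))); last by field; lra.
  by rewrite ler_piMr ?divr_ge0 ?ltW// ltr_pdivrMr; lra.
have e0 : 0 < Num.min (t * (eta / 2)) (s ^+ 2).
  by rewrite lt_min mulr_gt0 ?exprn_gt0// divr_gt0.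
have [w [Dw wP] hw] := hap _ e0.
have Dr := dformB_dom _ _ _ dir _ _ Dh Dw.
have -> : a u h - f h = a u (h \- w) - f (h \- w).
  by rewrite fB// (dformBr _ _ _ dir)// wP; ring.
move: hw; rewrite lt_min => /andP[hw1 hw2].
set r := h \- w in Dr hw1 hw2 *.
have fr : `|f r| <= eta / 2.
  apply: le_trans (fC _ Dr) _; apply: le_trans sC.
  apply: (@le_trans _ _ (`|C| * inorm m a r)).
    by rewrite ler_wpM2r ?sqrtr_ge0// ler_norm.
  rewrite ler_wpM2l// inormE -[leRHS]gtr0_norm// -sqrtr_sqr ler_wsqrtr//.
  exact: ltW.
(* Taking c = 1 and c = -1 in [form_young] bounds |a u r|, in place of the Cauchy-Schwarz
   inequality. *)
have half c : c ^+ 2 = 1 -> c * a u r <= eta / 2.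
  move=> c2; have Dcr := dformZ_dom _ _ _ dir c _ Dr.
  have := form_young _ _ _ dir t _ _ t0 Du Dcr.
  have Ducr := dformD_dom _ _ _ dir _ _ Du Dcr.
  rewrite (dformDl _ _ _ dir)// !(dformDr _ _ _ dir u)// (df_sym dir Dcr Du).
  rewrite (dformZr _ _ _ dir)// (dformZZ _ _ _ dir)// c2 mul1r.
  have : t^-1 * a r r <= eta / 2.
    rewrite mulrC ler_pdivrMr// mulrC; apply: le_trans (form_le_energy m a r) _.
    exact: ltW.
  lra.
have : `|a u r| <= eta / 2.
  rewrite ler_norml; have := half 1; have := half (-1).
  rewrite sqrrN expr1n => /(_ erefl) + /(_ erefl); rewrite mulN1r mul1r; lra.
have := ler_normB (a u r) (f r); lra.
Qed.

Lemma equation_bounded w (M : R) (K : set X) : D w -> 0 < M ->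
  (forall x, 0 <= w x <= M) -> compact K ->
  {ae m, forall x, ~ K x -> w x = 0} -> (forall x, K x -> u x <> psi x) ->
  a u w = f w.
Proof.
move=> Dw M0 wM cK wK uK.
have w0 x : 0 <= w x by have /andP[] := wM x.
suff : P w by case.
apply: (weak_limit m D a dir P w (2 * energy w + 2 * (M ^+ 2 * 4))) => //; first by move=> ? [].
  exact: L2_of.
(* The factor 4 is the cost of adding two exceptional functions, one for [u] and one for [psi]; the
   bound 1 keeps the energies of the approximations bounded as [d] tends to 0. *)
move=> d d0; pose d' := Num.min 1 (d / (4 * M ^+ 2)).
have M2 : 0 < M ^+ 2 by rewrite exprn_gt0.
have d'0 : 0 < d' by rewrite lt_min ltr01 divr_gt0// mulr_gt0.
have [F1 [e1 [F1cl uF1 [De1 e1_ge0 e1F energy1]]]] := quasi_continuous_closed_set m D a dir u d' u_qc d'0.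
have [F2 [e2 [F2cl psiF2 [De2 e2_ge0 e2F energy2]]]] := quasi_continuous_closed_set m D a dir psi d' psi_qc d'0.
pose e := e1 \+ e2; have De : D e by apply: (dformD_dom _ _ _ dir).
have e_ge0 x : 0 <= e x by apply: addr_ge0.
have Ee : energy e < 4 * d'.
  by have := energyD_le _ _ _ dir _ _ De1 De2; rewrite -/e; lra.
have Dv : D (shave M w e) by exact: (shave_dom _ _ _ dir).
have d'1 : d' <= 1 by rewrite ge_min lexx.
have d'2 : M ^+ 2 * (4 * d') <= d.
  have : d' <= d / (4 * M ^+ 2) by rewrite ge_min lexx orbT.
  by rewrite ler_pdivlMr ?mulr_gt0//; lra.
exists (shave M w e); split; last 2 first.
- apply: le_trans (energy_shave _ _ _ dir _ _ _ Dw De) _.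
  by rewrite lerD2l ler_pM2l// ler_pM2l//; lra.
- apply: le_lt_trans (ip_shave _ _ _ dir _ _ _ (ltW M0) Dw De w0) _.
  by apply: lt_le_trans d'2; rewrite ltr_pM2l.
split=> //.
pose K' := K `&` (F1 `&` F2).
have cK' : compact K'.
  apply: (subclosed_compact _ cK) => //; last exact: subIsetl.
  apply: closedI; [exact: compact_closed|exact: closedI].
have cont : {within K', continuous (fun x => u x - psi x)}.
  move=> x; apply: cvgB.
    by apply: (continuous_subspaceW _ uF1) => y [_ []].
  by apply: (continuous_subspaceW _ psiF2) => y [_ []].
(* The image of [K'] under u - psi is compact and misses 0, hence misses an interval around 0. *)
have [b b0 bP] : exists2 b : R, 0 < b & forall x, K' x -> b <= `|u x - psi x|.
  have := continuous_compact cont cK'.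
  move=> /(compact_closed (@Rhausdorff R)) /closed_openC.
  rewrite openE => /(_ 0) [].
    by move=> [x [Kx _] /eqP]; rewrite subr_eq0 => /eqP; exact: uK.
  move=> b b0 bP; exists b => // x K'x; rewrite leNgt; apply/negP => ub.
  apply: (bP (u x - psi x)); last by exists x.
  by rewrite /ball /= sub0r normrN.
have [[_ psiu] var] := u_solution.
have vM x : 0 <= shave M w e x <= M.
  rewrite /shave /pospart le_max lexx orbT/= ge_max (ltW M0) andbT.
  have := wM x => /andP[_]; have : 0 <= M * e x by rewrite mulr_ge0// ltW.
  by rewrite /=; lra.
have v0 : {ae m, forall x, ~ K' x -> shave M w e x = 0}.
  have e12 : {ae m, forall x, ~ (F1 `&` F2) x -> 1 <= e x}.
    apply: ae_mono2 e1F e2F => x e1x e2x /not_andP[/e1x|/e2x] h;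
    by rewrite /e /=; have := e1_ge0 x; have := e2_ge0 x; lra.
  apply: ae_mono2 wK e12 => x wx ex /not_andP[/wx{}wx|/ex{}ex];
    apply: max_idPr; rewrite /=.
  - by rewrite wx sub0r oppr_le0 mulr_ge0// ltW.
  - have /andP[_ wxM] := wM x.
    by rewrite subr_le0 (le_trans wxM)// ler_pMr.
(* The amplitude b / M keeps the variation at most [b] in absolute value, and [b] is at most u - psi
   a.e. on [K']; off [K'] the variation vanishes a.e. Both signs therefore respect the obstacle. *)
have feasible c : `|c| <= 1 -> obstacle_set m D psi (fun x => u x + c * (b / M) * shave M w e x).
  move=> c1; split.
    apply: (dformD_dom _ _ _ dir) => //; exact: (dformZ_dom _ _ _ dir).
  apply: ae_mono2 psiu v0 => x px vx.
  have [K'x|/vx ->] := pselect (K' x); last by rewrite mulr0 addr0.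
  have ub := bP x K'x; rewrite ger0_norm in ub; last by rewrite subr_ge0.
  have /andP[v_ge0 v_leM] := vM x.
  have : `|c * (b / M) * shave M w e x| <= b.
    rewrite -mulrA normrM -[leRHS]mul1r ler_pM//.
    rewrite ger0_norm; last by rewrite mulr_ge0// divr_ge0 ?ltW.
    by rewrite mulrAC ler_pdivrMr// ler_pM2l.
  by rewrite ler_norml => /andP[]; lra.
have ineq c : `|c| <= 1 -> c * (b / M) * f (shave M w e) <= c * (b / M) * a u (shave M w e).
  move=> c1; have := var _ (feasible c c1).
  have -> : (fun x => u x + c * (b / M) * shave M w e x) \- u =
    (fun x => c * (b / M) * shave M w e x) by apply/funext => x /=; ring.
  by rewrite fZ// (dformZr _ _ _ dir).
have bM : 0 < b / M by rewrite divr_gt0.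
have := ineq 1; have := ineq (-1); rewrite normrN normr1 lexx => /(_ isT) + /(_ isT).
rewrite !mulN1r !mul1r !mulNr lerN2 !ler_pM2l// => h1 h2.
by apply/eqP; rewrite eq_le h1 h2.
Qed.

(** Approximate [z] by [g] of compact support. The minimum of z^+ and g^+ vanishes a.e. off the
    intersection of the two supports, a compact set that avoids the contact set, so its truncations
    fall under [equation_bounded]. *)
Lemma equation_pospart z : D z -> supp m z `<=` ~` [set x | u x = psi x] ->
  compactly_approximable m D a z -> P (pospart z).
Proof.
move=> Dz zI [_ zap]; have Dzp := pospart_dom _ _ _ dir _ Dz.
(* The minimum of the two positive parts, written so that membership in [D] and the energy bound
   come from [pospart] and differences. *)
pose meet g := pospart z \- pospart (pospart z \- pospart g).
have meetE g x : meet g x = Num.min (pospart z x) (pospart g x).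
  rewrite /meet /= [X in _ - X]/pospart /=; set p := pospart z x; set q := pospart g x.
  by case: (leP p q) => pq; case: (leP (p - q) 0) => pq'; lra.
have Pmeet g : D g -> compact (supp m g) -> P (meet g).
  move=> Dg cg; have Dgp := pospart_dom _ _ _ dir _ Dg.
  have Dm : D (meet g).
    apply: (dformB_dom _ _ _ dir) => //; apply: (pospart_dom _ _ _ dir).
    exact: (dformB_dom _ _ _ dir).
  have meet0 x : 0 <= meet g x by rewrite meetE le_min /pospart !le_max lexx !orbT.
  have meetp : pospart (meet g) = meet g.
    by apply/funext => x; apply: max_idPl.
  rewrite -meetp.
  apply: (weak_limit_dominated m D a dir P (pospart (meet g)) (meet g) (fun n => trunc n.+1%:R (meet g)) (energy (meet g))) => //.
  - by move=> ? [].
  - by rewrite meetp; exact: L2_of.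
  - exact: L2_of.
  - move=> n; split; first exact: (trunc_dom _ _ _ dir).
    apply: (equation_bounded _ n.+1%:R (supp m z `&` supp m g)) => //.
    + exact: (trunc_dom _ _ _ dir).
    + by move=> x; rewrite /trunc le_min ge_min lexx ler0n le_max lexx orbT.
    + apply: (subclosed_compact _ cg); last exact: subIsetr.
      by apply: closedI; exact: closed_supp.
    + have := ae_eq0_off_supp m X_hausdorff m_radon g (L2_of _ Dg).
      have := ae_eq0_off_supp m X_hausdorff m_radon z (L2_of _ Dz).
      apply: ae_mono2 => x zx gx zgx; rewrite /trunc meetE /pospart.
      have -> : Num.min (Num.max (z x) 0) (Num.max (g x) 0) = 0.
        case/not_andP: zgx => [/zx ->|/gx ->]; rewrite maxxx.
          by apply: min_idPl; rewrite le_max lexx orbT.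
        by apply: min_idPr; rewrite le_max lexx orbT.
      by rewrite maxxx; apply: min_idPr.
    + by move=> x [/zI].
  - by move=> n; apply: (energy_trunc _ _ _ dir).
  - by move=> n x; apply: pospart_trunc_le.
  - by move=> x; exact: trunc_pospart_cvg.
apply: (weak_limit m D a dir P (pospart z) (2 * energy (pospart z) + 2 * (2 * energy (pospart z) + 2 * (2 * energy z + 2 * 1)))) => //.
- by move=> ? [].
- exact: L2_of.
move=> e e0.
(* The 1 bounds the energy of [g] in terms of that of [z]; the [e] controls the L^2 distance. The
   square root matches the one in [inorm]. *)
have [|g [Dg cg zg]] := zap (Num.sqrt (Num.min 1 e)).
  by rewrite sqrtr_gt0 lt_min ltr01.
have Dgp := pospart_dom _ _ _ dir _ Dg.
have Dzg := dformB_dom _ _ _ dir _ _ Dz Dg.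
have Dzpgp := dformB_dom _ _ _ dir _ _ Dzp Dgp.
have Dq := pospart_dom _ _ _ dir _ Dzpgp.
have Ezg : energy (z \- g) < Num.min 1 e.
  by move: zg; rewrite inormE ltr_sqrt// lt_min ltr01.
move: (Ezg); rewrite lt_min => /andP[Ezg1 Ezge].
exists (meet g); split; first exact: Pmeet.
  apply: le_trans (energyB_le _ _ _ dir _ _ Dzp Dq) _.
  rewrite lerD2l ler_pM2l//.
  apply: le_trans (energy_pospart _ _ _ dir _ Dzpgp) _.
  apply: le_trans (energyB_le _ _ _ dir _ _ Dzp Dgp) _.
  rewrite lerD2l ler_pM2l//.
  apply: le_trans (energy_pospart _ _ _ dir _ Dg) _.
  have -> : g = z \- (z \- g) by apply/funext => x /=; ring.
  apply: le_trans (energyB_le _ _ _ dir _ _ Dz Dzg) _.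
  by rewrite lerD2l ler_pM2l// ltW.
apply: le_lt_trans Ezge; apply: le_trans (ip_le_energy _ _ _ dir _ Dzg).
(* The difference (z^+ - g^+)^+ is at most |z - g|, the positive part being 1-Lipschitz. *)
have -> : pospart z \- meet g = pospart (pospart z \- pospart g).
  by apply/funext => x; rewrite /meet /=; ring.
apply: ip_le; [exact: L2_of..|]; apply: ae_true => x.
apply: le_trans (le_norm_pospart _ _) _; rewrite /pospart /=.
case: (leP (z x) 0) => zx; case: (leP (g x) 0) => gx; rewrite ?subrr ?normr0//.
- by rewrite sub0r normrN gtr0_norm// ler_normr; apply/orP; right; lra.
- by rewrite subr0 gtr0_norm// ler_normr; apply/orP; left; lra.
Qed.

(** The hypotheses on [z] are invariant under change of sign, so the equation holds for z^+ and
    (-z)^+, hence for their difference. *)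
Lemma obstacle_equation : equation_on m D a u f (~` [set x | u x = psi x]).
Proof.
move=> z Dz zI zap.
have DNz : D (fun x => -1 * z x) by exact: (dformZ_dom _ _ _ dir).
have suppN g : supp m (fun x => -1 * g x) = supp m g.
  rewrite /supp; congr (~` _); apply: eq_bigcupl; split => G [oG gG]; split => //.
    by apply: ae_mono gG => x gx /gx /eqP; rewrite mulN1r oppr_eq0 => /eqP.
  by apply: ae_mono gG => x gx /gx ->; rewrite mulr0.
have [Dp Pp] := equation_pospart z Dz zI zap.
have [] := equation_pospart (fun x => -1 * z x) DNz.
- by rewrite suppN.
- split => // e /(zap.2)[g [Dg cg zg]].
  exists (fun x => -1 * g x); split; [exact: (dformZ_dom _ _ _ dir)|by rewrite suppN|].
  move: zg; rewrite !inormE; congr (Num.sqrt _ < _).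
  have -> : (fun x => -1 * z x) \- (fun x => -1 * g x) = fun x => -1 * (z \- g) x.
    by apply/funext => x /=; ring.
  rewrite (energyZ _ _ _ dir); last exact: (dformB_dom _ _ _ dir).
  by rewrite sqrrN expr1n mul1r.
move=> Dn Pn.
have -> : z = pospart z \- pospart (fun x => -1 * z x).
  apply/funext => x; rewrite /pospart /= mulN1r.
  by case: (leP (z x) 0) => zx; case: (leP (- z x) 0) => zx'; lra.
by rewrite (dformBr _ _ _ dir)// fB// Pp Pn.
Qed.

End obstacle_equation.

(* The separating function is found on the one-point compactification, where it
   equals 1 at infinity; this is why its sublevel sets are precompact. *)
Lemma compact_open_separation {R : realType} {X : topologicalType} (K G : set X) :
  hausdorff_space X -> locally_compact [set: X] -> compact K -> open G -> K `<=` G ->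
  exists h : X -> R, [/\ continuous h, forall x, K x -> h x = 0,
    forall x, ~ G x -> h x = 1 &
    forall c, c < 1 -> precompact [set x | h x <= c]].
Proof.
move=> hX lcX cK oG KG; pose opc := one_point_compactification X.
have hopc : hausdorff_space opc by exact: one_point_compactification_hausdorff.
have nopc : normal_space opc.
  by apply: compact_normal => //; exact: one_point_compactification_compact.
have cSK : compact ((Some : X -> opc) @` K).
  apply: continuous_compact => //; apply: continuous_subspaceT.
  exact: one_point_compactification_some_continuous.
have oSG : open ((Some : X -> opc) @` G).
  exact: one_point_compactification_open_some.
have SKG : (Some : X -> opc) @` K `&` ~` ((Some : X -> opc) @` G) = set0.
  apply/disjoints_subset; rewrite setCK; exact: image_subset.
have := (@normal_separatorP R opc).1 nopc _ _ (compact_closed hopc cSK) (open_closedC oSG) SKG.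
move=> /(@uniform_separatorP _ R)[F [cF F01 FK FG]].
exists (F \o (Some : X -> opc)); split.
- move=> x; apply: continuous_comp; last exact: cF.
  exact: one_point_compactification_some_continuous.
- by move=> x Kx; apply: FK; exists (Some x) => //; exists x.
- by move=> x Gx; apply: FG; exists (Some x) => //= -[y Gy [yx]]; apply: Gx; rewrite -yx.
move=> c c1.
have F1 : F None = 1 by apply: FG; exists None => //= -[].
have /(cF (None : opc)) : nbhs (F None) [set r | c < r].
  by apply: open_nbhs_nbhs; split; [exact: open_gt|rewrite /= F1].
move=> [U [cU clU] UF]; exists U => // x /= Fx; apply: contrapT => nUx.
by have /(UF (Some x)) : ((Some : X -> opc) @` (~` U) `|` [set None]) (Some x);
  [left; exists x|rewrite /= ltNge Fx].
Qed.

(** * Continuous test functions of compact support in the domain *)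

Section test_functions.
Context {R : realType} {X : ptopologicalType}.
Context (X_hausdorff : hausdorff_space X).
Context (X_locally_compact : locally_compact [set: X]).
Context (m : {measure set (borel X) -> \bar R}).
Context (D : set (X -> R)) (a : (X -> R) -> (X -> R) -> R).
Context (dir : dirichlet_form m D a).
Context (a_cutoffs : has_cutoffs D).
Context (a_continuous : continuous_dense m D a).

Lemma min_dom p q : D p -> D q -> D (fun x => Num.min (p x) (q x)).
Proof.
move=> Dp Dq; have -> : (fun x => Num.min (p x) (q x)) = p \- pospart (p \- q).
  apply/funext => x; rewrite /pospart /=.
  by case: (leP (p x) (q x)) => pq; case: (leP (p x - q x) 0) => pq'; lra.
apply: (dformB_dom _ _ _ dir) => //; apply: (pospart_dom _ _ _ dir).
exact: (dformB_dom _ _ _ dir).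
Qed.

(** A cutoff [chi] need not be continuous, and a continuous element [g] of D[a] need not have
    compact support; [phi] combines the two by a minimum. It equals [trunc 1 g] on the open set [W]
    and 0 off [V], and the closure of [V] lies in [W], whence its continuity. *)
Lemma continuous_test_function (K G : set X) : compact K -> open G -> K `<=` G ->
  exists phi : X -> R, [/\ D phi, continuous phi, forall x, 0 <= phi x <= 1,
    forall x, K x -> phi x = 1 &
    compact (closure [set x | phi x != 0]) /\ closure [set x | phi x != 0] `<=` G].
Proof.
move=> cK oG KG.
have [h [ch hK hG hc]] := @compact_open_separation R X K G X_hausdorff X_locally_compact cK oG KG.
pose V := [set x | h x < 1 / 2]; pose W := [set x | h x < 3 / 4].
have oV : open V.
  by apply: (@open_comp _ _ h [set r | r < 1 / 2]).
have oW : open W.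
  by apply: (@open_comp _ _ h [set r | r < 3 / 4]).
have clVh : closure V `<=` [set x | h x <= 1 / 2].
  have cl : closed [set x | h x <= 1 / 2].
    have := (continuous_closedP h).1 ch _ (@closed_le R (1 / 2)); by [].
  by rewrite [X in _ `<=` X](closure_id _).1//; apply: closureS => x /ltW.
have pW : precompact W.
  by apply: (precompact_subset _ (hc (3 / 4) _)); [move=> x /ltW|lra].
have VW : closure V `<=` W by move=> x /clVh; rewrite /W /=; lra.
have cV : compact (closure V).
  rewrite -precompactE; apply: (precompact_subset _ pW) => x Vx.
  by apply: VW; exact: subset_closure.
have [chi [Dchi chiV chiW]] := a_cutoffs _ _ cV oW pW VW.
have cW : compact (closure W) by rewrite -precompactE.
(* This function is 3 / 2 on [K] and at most -1 / 2 off [V]. An approximation [g] within 1 / 2 is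
   thus at least 1 on [K] and at most 0 on [W] outside [V]. *)
have cH : continuous (fun x => 3 / 2 - 4 * h x).
  by move=> x; apply: cvgB; [exact: cvg_cst|apply: cvgM; [exact: cvg_cst|exact: ch]].
have [_ dense] := a_continuous.
have half_gt0 : 0 < 1 / 2 :> R by lra.
have [g [cg Dg hg]] := dense _ cH (closure W) cW (1 / 2) half_gt0.
have gV x : W x -> ~ V x -> g x <= 0.
  move=> /subset_closure /hg; rewrite ltr_norml => /andP[h1 h2] /negP.
  by rewrite -leNgt; lra.
have gK x : K x -> 1 <= g x.
  move=> Kx; have Wx : W x by rewrite /W /= hK//; lra.
  move: (hg x (subset_closure Wx)); rewrite hK// ltr_norml => /andP[]; lra.
pose phi := fun x => Num.min (trunc 1 g x) (pospart chi x).
have phiW x : W x -> phi x = trunc 1 g x.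
  move=> Wx; rewrite /phi /pospart; have [Vx|nVx] := pselect (V x).
    rewrite chiV; last exact: subset_closure.
    by apply/min_idPl; rewrite /trunc ge_min le_max lexx.
  rewrite /trunc (max_idPr (gV x Wx nVx)) (min_idPr ler01).
  by apply/min_idPl; rewrite le_max lexx orbT.
have t01 x : 0 <= trunc 1 g x <= 1.
  by rewrite /trunc le_min ge_min lexx ler01 le_max lexx orbT.
have phiV x : ~ V x -> phi x = 0.
  move=> nVx; have [Wx|nWx] := pselect (W x).
    by rewrite phiW// /trunc (max_idPr (gV x Wx nVx)); apply/min_idPr.
  rewrite /phi /pospart chiW// maxxx; apply/min_idPr.
  by have /andP[] := t01 x.
have phiS : [set x | phi x != 0] `<=` V.
  by move=> x /eqP phix; apply: contrapT => /phiV.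
exists phi; split.
- by apply: min_dom; [exact: (trunc_dom _ _ _ dir)|exact: (pospart_dom _ _ _ dir)].
- move=> x; have [Wx|nWx] := pselect (W x).
    have ct : {for x, continuous (trunc 1 g)}.
      apply: (@continuous_min _ _ (cst 1) (pospart g)); first exact: cvg_cst.
      by apply: continuous_max; [exact: cg|exact: cvg_cst].
    rewrite /continuous_at phiW//; apply: cvg_trans ct; apply: near_eq_cvg.
    have : nbhs x W by exact: open_nbhs_nbhs.
    by apply: filterS => y /phiW.
  rewrite /continuous_at phiV; last first.
    by move=> Vx; apply: nWx; apply: VW; exact: subset_closure.
  apply: cvg_near_cst.
  have : nbhs x (~` closure V).
    apply: open_nbhs_nbhs; split; first exact/closed_openC/closed_closure.
    by move=> /VW.
  by apply: filterS => y Vy; apply: phiV => /subset_closure.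
- move=> x; have /andP[t0 t1] := t01 x.
  by rewrite /phi le_min ge_min t0 t1 /pospart le_max lexx orbT.
- move=> x Kx; have Wx : W x by rewrite /W /= hK//; lra.
  rewrite phiW// /trunc (max_idPl _); last by have := gK x Kx; lra.
  by apply/min_idPl/gK.
split.
  apply: (subclosed_compact _ cV); first exact: closed_closure.
  exact: closureS.
move=> x /(closureS phiS) /clVh /= hx; apply: contrapT => /hG hx1.
by move: hx; rewrite hx1; lra.
Qed.

End test_functions.

(** * Squares of elements of the domain with values in [0, 1] *)

Definition excess {R : realType} {X : Type} (s : R) (g : X -> R) : X -> R :=
  fun x => Num.max (g x - s) 0.

(** The mean of (g - t)^+ over the left endpoints t of the 2^k equal subintervals of [s, s + d],
    arranged as iterated midpoints. *)
Fixpoint dyadic_mean {R : realType} {X : Type} (g : X -> R) (k : nat) (s d : R) : X -> R :=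
  if k is k'.+1 then
    fun x => 2^-1 * (dyadic_mean g k' s (d / 2) \+ dyadic_mean g k' (s + d / 2) (d / 2)) x
  else excess s g.

Section square.
Context {R : realType} {X : ptopologicalType}.
Context (m : {measure set (borel X) -> \bar R}).
Context (D : set (X -> R)) (a : (X -> R) -> (X -> R) -> R).
Context (dir : dirichlet_form m D a).
Implicit Types g : X -> R.
Local Notation energy := (energy m a).

(** (g - s)^+ is g^+ minus the truncation at s. The case s = 0 is separate because truncation levels
    are positive. *)
Lemma excess_energy s g : 0 <= s -> D g -> D (excess s g) /\ energy (excess s g) <= 4 * energy g.
Proof.
move=> s_ge0 Dg; have Dp := pospart_dom _ _ _ dir _ Dg.
have Ep := energy_pospart _ _ _ dir _ Dg; have Eg := energy_ge0 _ _ _ dir _ Dg.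
have [s0|s0] := eqVneq s 0.
  have -> : excess s g = pospart g by apply/funext => x; rewrite /excess s0 subr0.
  by split=> //; lra.
have s_gt0 : 0 < s by rewrite lt0r s0.
have Dt := trunc_dom _ _ _ dir _ _ s_gt0 Dg.
have Et := energy_trunc _ _ _ dir _ _ s_gt0 Dg.
have -> : excess s g = pospart g \- trunc s g.
  apply/funext => x; rewrite /excess /pospart /trunc /=.
  case: (leP (g x) 0) => g0; first by rewrite (min_idPr s_ge0); case: (leP (g x - s) 0); lra.
  by case: (leP s (g x)) => sg; case: (leP (g x - s) 0) => gs; lra.
split; first exact: (dformB_dom _ _ _ dir).
by have := energyB_le _ _ _ dir _ _ Dp Dt; lra.
Qed.

Lemma dyadic_mean_energy g k s d : 0 <= s -> 0 <= d -> D g ->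
  D (dyadic_mean g k s d) /\ energy (dyadic_mean g k s d) <= 4 * energy g.
Proof.
elim: k s d => [|k IH] s d s0 d0 Dg /=; first exact: excess_energy.
have d20 : 0 <= d / 2 by rewrite divr_ge0.
have [D1 E1] := IH s (d / 2) s0 d20 Dg.
have [D2 E2] := IH (s + d / 2) (d / 2) (addr_ge0 s0 d20) d20 Dg.
split; first exact: (dom_midpoint_convex _ _ _ dir).
rewrite (energyZ _ _ _ dir); last exact: (dformD_dom _ _ _ dir).
have := energyD_le _ _ _ dir _ _ D1 D2; rewrite expr2; lra.
Qed.

Lemma dyadic_mean_bound g k s d x : 0 <= s -> 0 <= d -> 0 <= g x ->
  0 <= dyadic_mean g k s d x <= g x.
Proof.
elim: k s d => [|k IH] s d s0 d0 g0 /=.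
  by rewrite /excess le_max lexx orbT /= ge_max g0 andbT gerBl.
have d20 : 0 <= d / 2 by rewrite divr_ge0.
have /andP[] := IH s (d / 2) s0 d20 g0.
have /andP[] := IH (s + d / 2) (d / 2) (addr_ge0 s0 d20) d20 g0.
lra.
Qed.

(* The mean of [(g - t)^+] over [s, s + d] is
   [(((g - s)^+)^2 - ((g - s - d)^+)^2) / (2 d)]. *)
Lemma dyadic_mean_error g k s d x : 0 < d ->
  `|((excess s g x) ^+ 2 - (excess (s + d) g x) ^+ 2) / (2 * d) - dyadic_mean g k s d x|
    <= d / 2 ^+ k.
Proof.
elim: k s d => [|k IH] s d d0 /=.
  rewrite expr0 divr1 /excess opprD addrA; set y := g x - s.
  case: (leP y 0) => y0.
    have -> : Num.max (y - d) 0 = 0 by apply/max_idPr; lra.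
    by rewrite subrr mul0r subrr normr0 ltW.
  case: (leP (y - d) 0) => yd.
    rewrite [X in `|X|](_ : _ = - (y * ((2 * d - y) / (2 * d)))); last by field; lra.
    rewrite normrN ger0_norm; last first.
      by rewrite mulr_ge0 ?divr_ge0//; lra.
    rewrite mulrA ler_pdivrMr; last lra.
    nra.
  rewrite [X in `|X|](_ : _ = - (d / 2)); last by field; lra.
  by rewrite normrN ger0_norm; lra.
have d2 : 0 < d / 2 by rewrite divr_gt0.
have h1 := IH s (d / 2) d2; have h2 := IH (s + d / 2) (d / 2) d2.
rewrite -addrA -splitr in h2.
move: h1 h2; set p := excess s g x; set q := excess (s + d / 2) g x; set r := excess (s + d) g x.
set A1 := dyadic_mean _ _ _ _ _; set A2 := dyadic_mean _ _ _ _ _.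
have k0 : 2 ^+ k != 0 :> R by rewrite expf_neq0.
rewrite [d / 2 ^+ k.+1](_ : _ = d / 2 / 2 ^+ k); last by rewrite exprS; field.
rewrite [X in _ -> _ -> `|X| <= _](_ : _ = 2^-1 * ((p ^+ 2 - q ^+ 2) / (2 * (d / 2)) - A1)
  + 2^-1 * ((q ^+ 2 - r ^+ 2) / (2 * (d / 2)) - A2)); last by field; lra.
set B1 := _ - A1; set B2 := _ - A2; set Z := d / 2 / _ => h1 h2.
apply: le_trans (ler_normD _ _) _; rewrite !normrM gtr0_norm ?invr_gt0//.
lra.
Qed.

(** For 0 <= g <= 1, g^2 / 2 is the mean of (g - t)^+ over t in [0, 1], hence the weak limit of
    dyadic means of bounded energy. It allows strong locality to be applied to the squared term in
    the formula for the energy measure. *)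
Lemma square_dom g : D g -> (forall x, 0 <= g x <= 1) -> D (fun x => g x ^+ 2).
Proof.
move=> Dg g01; have Lg := df_L2 dir Dg.
have half_dom : D (fun x => g x ^+ 2 / 2).
  apply: (weak_limit_dominated m D a dir D _ g (fun k => dyadic_mean g k 0 1) (4 * energy g)) => //.
  - exact: (dom_midpoint_convex _ _ _ dir).
  - have mg := L2_measurable m g Lg.
    apply: (L2_le m g) => //; first by apply: measurable_funM => //; exact: measurable_funX.
    apply: ae_true => x; have /andP[g0 g1] := g01 x.
    by rewrite ger0_norm ?divr_ge0 ?sqr_ge0// ger0_norm// expr2; nra.
  - by move=> n; have [] := dyadic_mean_energy g n 0 1 (lexx _) ler01 Dg.
  - by move=> n; have [] := dyadic_mean_energy g n 0 1 (lexx _) ler01 Dg.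
  - move=> n x; have /andP[g0 g1] := g01 x.
    have /andP[b0 b1] := dyadic_mean_bound g n 0 1 x (lexx _) ler01 g0.
    rewrite [leRHS]ger0_norm// ler_norml expr2; nra.
  - move=> x; apply/cvgr0Pnorm_le => e e0.
    have /cvgr0Pnorm_le/(_ e e0) := @cvg_expr R (2^-1) ltac:(rewrite gtr0_norm; lra).
    apply: filterS => n; rewrite ger0_norm ?exprn_ge0// => ne.
    apply: le_trans ne; have := dyadic_mean_error g n 0 1 x ltr01.
    have /andP[g0 g1] := g01 x.
    rewrite /excess add0r subr0 (max_idPl g0) (max_idPr _) ?subr_le0//.
    by rewrite expr0n subr0 mulr1 div1r exprVn.
have := dformZ_dom _ _ _ dir 2 _ half_dom; congr D.
by apply/funext => x; field.
Qed.

End square.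

(** * The energy form localized to a Borel set, and its kernel *)

Section energy_measure_kernel.
Context {R : realType} {X : ptopologicalType}.
Context (m : {measure set (borel X) -> \bar R}).
Context (D : set (X -> R)) (a : (X -> R) -> (X -> R) -> R).
Context (dir : dirichlet_form m D a).
Context (mu : (X -> R) -> (X -> R) -> {charge set (borel X) -> \bar R}).
Context (mu_energy : energy_measure m D a mu).
Implicit Types u v w g h : X -> R.
Local Notation energy := (energy m a).

Lemma energy_measure_mono u (A B : set (borel X)) : D u -> measurable A ->
  measurable B -> A `<=` B -> (mu u u A <= mu u u B)%E.
Proof.
move=> Du mA mB AB; have [nu [munu _ _]] := em_energy mu_energy Du.
by rewrite !munu//; apply: le_measure => //; exact: mem_set.
Qed.

Lemma energy_measure_ae u v (A : set (borel X)) : D u -> D v -> measurable A ->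
  {ae m, forall x, u x = v x} -> mu u u A = mu v v A.
Proof.
move=> Du Dv mA uv; have := em_localization mu_energy openT Du Dv _ mA.
by rewrite setIT; apply; apply: ae_mono uv.
Qed.

Context (A : set (borel X)).
Context (mA : measurable A).

Let b u v := fine (mu u v A).

Let muE u v : mu u v A = (b u v)%:E.
Proof. by rewrite /b fineK// fin_num_measure. Qed.

Let b_lin c u v w : D u -> D v -> D w ->
  b (fun x => c * u x + v x) w = c * b u w + b v w.
Proof.
move=> Du Dv Dw; have := em_bilinear mu_energy c Du Dv Dw mA.
by rewrite !muE -EFinM -EFinD => -[].
Qed.

Let b_sym u v : D u -> D v -> b u v = b v u.
Proof. by move=> Du Dv; rewrite /b (em_sym mu_energy Du Dv mA). Qed.

Let b_ge0 u : D u -> 0 <= b u u.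
Proof. by move=> Du; rewrite -lee_fin -muE (em_ge0 mu_energy). Qed.

Let b_le u : D u -> b u u <= a u u.
Proof.
move=> Du; rewrite -lee_fin -muE -(em_total mu_energy Du Du).
exact: energy_measure_mono.
Qed.

Let b_quad c u v : D u -> D v ->
  b (fun x => c * u x + v x) (fun x => c * u x + v x) = c ^+ 2 * b u u + 2 * c * b u v + b v v.
Proof.
move=> Du Dv; have Duv := df_linear dir c Du Dv.
rewrite b_lin// (b_sym u)// (b_sym v)// !b_lin// (b_sym v u)//; ring.
Qed.

Definition null_energy : set (X -> R) := [set w | D w /\ mu w w A = 0%E].

(** The energy of c u + v on [A] is affine in [c] and nonnegative for every [c], so its slope is
    0. *)
Lemma null_energy_cross u v : null_energy u -> D v -> mu u v A = 0%E.
Proof.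
move=> [Du]; rewrite !muE => -[u0] Dv; congr EFin.
apply: contrapT => /eqP uv0.
(* This [c] would make the energy of c u + v on [A] equal to -1. *)
pose c := - (b v v + 1) / (2 * b u v).
have := b_ge0 _ (df_linear dir c Du Dv); rewrite b_quad// u0 mulr0 add0r.
rewrite (_ : 2 * c * b u v = - (b v v + 1)); first by lra.
by rewrite /c; field.
Qed.

Lemma null_energy_linear c u v : null_energy u -> null_energy v ->
  null_energy (fun x => c * u x + v x).
Proof.
move=> nu nv; have [Du u0] := nu; have [Dv v0] := nv.
split; first exact: (df_linear dir).
have uv := null_energy_cross _ _ nu Dv.
move: u0 v0 uv; rewrite !muE b_quad// => -[->] [->] [->].
by rewrite !mulr0 !addr0.
Qed.

Lemma null_energy0 : null_energy (fun=> 0).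
Proof.
split; first exact: (df_zero dir).
have := b_quad (-1) _ _ (df_zero dir) (df_zero dir); rewrite muE.
rewrite (_ : (fun _ => _) = fun=> 0); last by apply/funext => x; rewrite mulr0 addr0.
by move=> h; congr EFin; lra.
Qed.

Lemma null_energyZ c u : null_energy u -> null_energy (fun x => c * u x).
Proof.
move=> nu; have := null_energy_linear c _ _ nu null_energy0.
by congr null_energy; apply/funext => x; rewrite addr0.
Qed.

Lemma null_energyD u v : null_energy u -> null_energy v -> null_energy (u \+ v).
Proof.
move=> nu nv; have := null_energy_linear 1 _ _ nu nv.
by congr null_energy; apply/funext => x; rewrite mul1r.
Qed.

Lemma null_energy_convex : midpoint_convex null_energy.
Proof. by move=> u v nu nv; apply: null_energyZ; exact: null_energyD. Qed.

(** For null [w] and r = h - w, nonnegativity at r - w gives 2 b w r <= b r r, whence b h h <= 2 b r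
    r <= 2 a r r; this explains the tolerance e / 2. *)
Lemma null_energy_closed : energy_closed m D a null_energy.
Proof.
move=> h Dh hap; split => //; rewrite muE; congr EFin.
apply/eqP; rewrite eq_le b_ge0// andbT; apply/ler_addgt0Pr => e e0; rewrite add0r.
have [w [Dw w0] hw] := hap (e / 2) (divr_gt0 e0 (ltr0n _ 2)).
have Dr := dformB_dom _ _ _ dir _ _ Dh Dw.
have hE : h = fun x => 1 * w x + (h \- w) x by apply/funext => x /=; ring.
have := b_quad 1 _ _ Dw Dr; rewrite -hE.
have := b_quad (-1) _ _ Dw Dr.
have := b_ge0 _ (df_linear dir (-1) Dw Dr).
have := le_lt_trans (form_le_energy m a (h \- w)) hw.
have := b_le _ Dr; move: w0; rewrite muE => -[].
rewrite sqrrN expr1n; lra.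
Qed.

End energy_measure_kernel.

(** * The energy measure does not charge level sets *)

Section level_sets.
Context {R : realType} {X : ptopologicalType}.
Context (X_hausdorff : hausdorff_space X).
Context (X_locally_compact : locally_compact [set: X]).
Context (m : {measure set (borel X) -> \bar R}).
Context (D : set (X -> R)) (a : (X -> R) -> (X -> R) -> R).
Context (dir : dirichlet_form m D a).
Context (a_local : strongly_local m D a).
Context (mu : (X -> R) -> (X -> R) -> {charge set (borel X) -> \bar R}).
Context (mu_energy : energy_measure m D a mu).
Context (a_cutoffs : has_cutoffs D).
Context (a_continuous : continuous_dense m D a).
Implicit Types u v w g h : X -> R.
Local Notation energy := (energy m a).
Let L2_of w : D w -> L2 m w. Proof. exact: (df_L2 dir). Qed.

Lemma supp_closure phi : supp m phi `<=` closure [set x | phi x != 0].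
Proof.
move=> x sx; apply: contrapT => ncl; apply: sx.
exists (~` closure [set x | phi x != 0]) => //; split.
  exact/closed_openC/closed_closure.
apply: ae_true => y ny; apply/eqP/negPn/negP => phiy.
by apply: ny; exact: subset_closure.
Qed.

(** For a test function [phi] supported in [G], strong locality annihilates both terms of the
    formula for the integral of [phi]. Taking [phi] equal to 1 on a compact [K] shows that [K] is
    not charged, and inner regularity extends this to [G]. *)
Lemma energy_measure_constant1 (G : set X) g : open G -> D g ->
  (forall x, 0 <= g x <= 1) -> {ae m, forall x, G x -> g x = 1} ->
  mu g g G = 0%E.
Proof.
move=> oG Dg g01 gG; have mG := open_borel G oG.
(* A representative equal to 1 everywhere on [G], so that g' phi = phi holds as an identity of
   functions. *)
pose g' : X -> R := fun x => Num.max (g x) (\1_G x).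
have g'G x : G x -> g' x = 1.
  move=> Gx; rewrite /g' indicE mem_set//; apply/max_idPr.
  by have /andP[] := g01 x.
have g'_ge0 x : 0 <= g' x by rewrite le_max; have /andP[->] := g01 x.
have g'01 x : 0 <= g' x <= 1.
  rewrite g'_ge0 /g' ge_max; have /andP[_ ->] := g01 x.
  by rewrite indicE lern1 leq_b1.
have gg' : {ae m, forall x, g x = g' x}.
  apply: ae_mono gG => x gx; rewrite /g' indicE.
  have [Gx|nGx] := pselect (G x); first by rewrite gx// mem_set// maxxx.
  by rewrite memNset//; apply/esym/max_idPl; have /andP[] := g01 x.
have Dg' : D g'.
  apply: (df_saturated dir Dg _ gg').
  apply: (L2_le m g); first exact: L2_of.
    apply: measurable_maxr; first exact: (L2_measurable m g (L2_of _ Dg)).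
    exact: measurable_indic.
  by apply: ae_mono gg' => x ->.
rewrite (energy_measure_ae m D a mu mu_energy g g')//.
have [nu [munu [_ _ nu_inner] nu_form]] := em_energy mu_energy Dg'.
rewrite munu//; apply/eqP; rewrite eq_le measure_ge0 andbT nu_inner//.
apply: ge_ereal_sup => _ [K [cK KG] <-].
have [phi [Dphi cphi phi01 phiK [cS SG]]] := continuous_test_function X_hausdorff X_locally_compact m D a dir a_cutoffs a_continuous K G cK oG KG.
have gphi : (fun x => g' x * phi x) = phi.
  apply/funext => x; have [->|phix] := eqVneq (phi x) 0; first by rewrite mulr0.
  by rewrite g'G ?mul1r//; apply/SG/subset_closure.
have Dg2 := square_dom m D a dir _ Dg' g'01.
have a1 : a g' phi = 0.
  by apply: (a_local _ _ 1) => //; apply: ae_true => x /supp_closure/SG/g'G.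
have a2 : a (fun x => g' x ^+ 2) phi = 0.
  by apply: (a_local _ _ 1) => //; apply: ae_true => x /supp_closure/SG/g'G ->; rewrite expr1n.
have := nu_form _ phi Dphi cphi cS.
rewrite gphi a1 a2 mulr0 subr0 => int0.
have mphi := L2_measurable m phi (L2_of _ Dphi).
have iphi : nu.-integrable [set: borel X] (EFin \o phi).
  apply: (@le_integrable _ _ _ nu [set: borel X] measurableT _ (EFin \o cst 1)) => //.
  - exact/measurable_EFinP.
  - move=> x _ /=; rewrite lee_fin normr1; have /andP[p0 p1] := phi01 x.
    by rewrite ger0_norm.
  - exact: finite_measure_integrable_cst.
have {}int0 : (\int[nu]_x (phi x)%:E = 0)%E.
  rewrite -[LHS]fineK; last exact: integrable_fin_num.
  congr EFin; apply: int0; exists 1 => x.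
  by have /andP[h0 h1] := g'01 x; rewrite ger0_norm.
have mK : measurable (K : set (borel X)).
  rewrite -(setCK K); apply: measurableC; apply: open_borel.
  by apply: closed_openC; exact: compact_closed.
rewrite -int0; apply: (@le_trans _ _ (\int[nu]_x (\1_K x)%:E)%E).
  by rewrite integral_indic// setIT.
apply: ge0_le_integral => //.
- exact/measurable_EFinP/measurable_indic.
- exact/measurable_EFinP.
move=> x _; rewrite lee_fin indicE.
have [/set_mem Kx|] := boolP (x \in K); first by rewrite phiK.
by move=> _; have /andP[] := phi01 x.
Qed.

Context (u : X -> R) (c : R).
Context (Du : D u).
Context (u_qc : quasi_continuous m D a u).
Let I : set (borel X) := [set x | u x = c].

Let mI : measurable I.
Proof.
have mu' := L2_measurable m u (L2_of _ Du).
rewrite -[X in measurable X]setTI.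
exact: (mu' measurableT [set c] (measurable_set1 c)).
Qed.

Let N := null_energy D mu I.

(** The set where [u] lies in [U] is relatively open in a closed [F] whose complement has small
    capacity. Adding that complement makes it open, at the price of points where e >= 1. *)
Lemma quasi_open_enlargement (U : set R) (d : R) : open U -> U c -> 0 < d ->
  exists G e, [/\ open G, I `<=` G, D e /\ (forall x, 0 <= e x), energy e < d &
    {ae m, forall x, G x -> U (u x) \/ 1 <= e x}].
Proof.
move=> oU Uc d0.
have [F [e [Fcl uF [De e0 eF Ee]]]] := quasi_continuous_closed_set m D a dir u d u_qc d0.
have /open_subspaceP[V oV VF] : open (u @^-1` U : set (subspace F)).
  by apply: open_comp => // x _; exact: uF.
exists (V `|` ~` F), e; split => //.
- by apply: openU => //; exact: closed_openC.
- move=> x Ix; have [Fx|nFx] := pselect (F x); [left|by right].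
  have : (u @^-1` U `&` F) x by split => //; rewrite /= Ix.
  by rewrite -VF => -[].
- apply: ae_mono eF => x ex [Vx|/ex]; last by right.
  have [Fx|/ex] := pselect (F x); last by right.
  by left; have : (V `&` F) x by []; rewrite VF => -[].
Qed.

(** Shaving by [e] makes a bounded [w] vanish a.e. on an open set [G] containing the level set,
    where localization compares it with 0. Letting the energy of [e] tend to 0 recovers [w];
    unbounded [w] are limits of truncations. *)
Lemma null_energy_vanishing w (U : set R) : D w -> (forall x, 0 <= w x) ->
  open U -> U c -> (forall x, U (u x) -> w x = 0) -> N w.
Proof.
move=> Dw w0 oU Uc wU.
have bounded v (M : R) : 0 < M -> D v -> (forall x, 0 <= v x <= M) ->
    (forall x, U (u x) -> v x = 0) -> N v.
  move=> M0 Dv v0M vU; have v0 x : 0 <= v x by have /andP[] := v0M x.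
  apply: (weak_limit m D a dir N v (2 * energy v + 2 * M ^+ 2)).
  - by move=> ? [].
  - exact: (null_energy_convex m D a dir).
  - exact: null_energy_closed.
  - exact: L2_of.
  move=> d d0; have M2 : 0 < M ^+ 2 by rewrite exprn_gt0.
  (* The 1 bounds the energies of the approximations, and d / M^2 their squared L^2 distance to
     [v]. *)
  have d'0 : 0 < Num.min 1 (d / M ^+ 2) by rewrite lt_min ltr01 divr_gt0.
  have [G [e [oG IG [De e0] Ee eG]]] := quasi_open_enlargement U _ oU Uc d'0.
  move: Ee; rewrite lt_min => /andP[Ee1 Eed].
  have Ds := shave_dom _ _ _ dir M _ _ Dv De.
  exists (shave M v e); split.
  - split => //; apply/eqP; rewrite eq_le (em_ge0 mu_energy)// andbT.
    have mG := open_borel G oG.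
    apply: le_trans (energy_measure_mono m D a mu mu_energy _ _ _ Ds mI mG IG) _.
    have := @em_localization _ _ _ _ _ _ mu_energy G (shave M v e) (fun=> 0) oG Ds (df_zero dir) _ G mG.
    rewrite setIid => ->; last first.
      apply: ae_mono eG => x eGx /eGx h; apply/max_idPr; rewrite /=.
      case: h => [/vU ->|ex]; first by rewrite sub0r oppr_le0 mulr_ge0// ltW.
      have /andP[_ vM] := v0M x.
      by rewrite subr_le0 (le_trans vM)// ler_pMr.
    by have [_ ->] := null_energy0 m D a dir mu mu_energy G mG.
  - apply: le_trans (energy_shave _ _ _ dir _ _ _ Dv De) _.
    by rewrite lerD2l ler_pM2l// ler_piMr ?ltW.
  - apply: le_lt_trans (ip_shave _ _ _ dir _ _ _ (ltW M0) Dv De v0) _.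
    by rewrite mulrC -ltr_pdivlMr.
have wE : pospart w = w by apply/funext => x; apply/max_idPl.
rewrite -wE.
apply: (weak_limit_dominated m D a dir N (pospart w) w (fun n => trunc n.+1%:R w) (energy w)).
- by move=> ? [].
- exact: (null_energy_convex m D a dir).
- exact: null_energy_closed.
- by rewrite wE; exact: L2_of.
- exact: L2_of.
- move=> n; apply: (bounded _ n.+1%:R) => //.
  + exact: (trunc_dom _ _ _ dir).
  + by move=> x; rewrite /trunc le_min ge_min lexx ler0n le_max lexx orbT.
  + by move=> x /wU wx; rewrite /trunc wx maxxx; apply/min_idPr.
- by move=> n; apply: (energy_trunc _ _ _ dir).
- by move=> n x; apply: pospart_trunc_le.
- by move=> x; exact: trunc_pospart_cvg.
Qed.

(** Here [e] is added rather than subtracted: the minimum of 1 and w + e is a.e. 1 on [G] and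
    differs from [w] by at most [e]. *)
Lemma null_energy_constant1 w (U : set R) : D w -> (forall x, 0 <= w x <= 1) ->
  open U -> U c -> (forall x, U (u x) -> w x = 1) -> N w.
Proof.
move=> Dw w01 oU Uc wU.
apply: (weak_limit m D a dir N w (2 * energy w + 2 * 1)).
- by move=> ? [].
- exact: (null_energy_convex m D a dir).
- exact: null_energy_closed.
- exact: L2_of.
move=> d d0.
have d'0 : 0 < Num.min 1 d by rewrite lt_min ltr01.
have [G [e [oG IG [De e0] Ee eG]]] := quasi_open_enlargement U _ oU Uc d'0.
move: Ee; rewrite lt_min => /andP[Ee1 Eed].
have Dwe := dformD_dom _ _ _ dir _ _ Dw De.
have Dt := trunc_dom _ _ _ dir _ _ ltr01 Dwe.
have we0 x : 0 <= w x + e x by rewrite addr_ge0//; have /andP[] := w01 x.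
exists (trunc 1 (w \+ e)); split.
- split => //; apply/eqP; rewrite eq_le (em_ge0 mu_energy)// andbT.
  have mG := open_borel G oG.
  apply: le_trans (energy_measure_mono m D a mu mu_energy _ _ _ Dt mI mG IG) _.
  rewrite energy_measure_constant1//.
    by move=> x; rewrite /trunc le_min ge_min lexx ler01 le_max lexx orbT.
  apply: ae_mono eG => x eGx /eGx h; rewrite /trunc /= (max_idPl (we0 x)).
  apply/min_idPl; have /andP[w0 _] := w01 x; have := e0 x.
  by case: h => [/wU ->|]; lra.
- apply: le_trans (energy_trunc _ _ _ dir _ _ ltr01 Dwe) _.
  by apply: le_trans (energyD_le _ _ _ dir _ _ Dw De) _; lra.
- apply: le_lt_trans Eed; apply: le_trans (ip_le_energy _ _ _ dir _ De).
  apply: ip_le; [apply: L2B; exact: L2_of|exact: L2_of|].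
  apply: ae_true => x; rewrite /trunc /= (max_idPl (we0 x)).
  have /andP[_ w1] := w01 x; have ex := e0 x.
  rewrite (ger0_norm ex) ler_norml.
  by case: (leP 1 (w x + e x)) => h; lra.
Qed.

(** Rests on u = (u - c)^+ + min(c, u^+) - (-u)^+. In each summand a slight shift of the level makes
    it constant wherever [u] is near [c]. *)
Lemma null_energy_level : 0 <= c -> N u.
Proof.
move=> c0.
have N_of h (w : nat -> X -> R) g : D g -> L2 m h -> (forall n, N (w n)) ->
    (exists B : R, forall n, energy (w n) <= B) -> (forall n x, `|h x - w n x| <= `|g x|) ->
    (forall x, (fun n => h x - w n x) @ \oo --> 0) -> N h.
  move=> Dg Lh Nw [B wB] hg hw.
  apply: (weak_limit_dominated m D a dir N h g w B) => //.
  - by move=> ? [].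
  - exact: (null_energy_convex m D a dir).
  - exact: null_energy_closed.
  - exact: L2_of.
pose s (n : nat) : R := n.+1%:R^-1.
have s0 n : 0 < s n by rewrite invr_gt0.
have excess_cvg v (t : R) x : 0 <= t -> (fun n => excess t v x - excess (t + s n) v x) @ \oo --> 0.
  move=> t0; apply/cvgr0Pnorm_le => e e0.
  have [n0 _ n0P] := near_infty_natSinv_lt (PosNum e0).
  exists n0 => // n n0n; apply: le_trans (ltW (n0P n n0n)); rewrite /= -/(s n) /excess.
  have sn := s0 n; rewrite ler_norml.
  by case: (leP (v x - t) 0) => h; case: (leP (v x - (t + s n)) 0) => h'; lra.
have excess_le v (t : R) n x : 0 <= t -> `|excess t v x - excess (t + s n) v x| <= `|v x|.
  move=> t0; have sn := s0 n; rewrite /excess.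
  case: (leP (v x - t) 0) => h; case: (leP (v x - (t + s n)) 0) => h'; rewrite ?subrr ?normr0//.
  - by lra.
  - by rewrite subr0 !ger0_norm; lra.
  - by rewrite !ger0_norm; lra.
(* By hypothesis [v] is at most t + s n wherever [u] is close enough to [c], so raising the level
   from [t] to t + s n makes the excess vanish there. *)
have Ncut v (t : R) : D v -> 0 <= t ->
    (forall n, exists U, [/\ open U, U c & forall x, U (u x) -> v x <= t + s n]) -> N (excess t v).
  move=> Dv t0 vU; have ts n : 0 <= t + s n by rewrite addr_ge0// ltW.
  apply: (N_of _ (fun n => excess (t + s n) v) v) => //.
  - by apply: L2_of; have [] := excess_energy m D a dir t v t0 Dv.
  - move=> n; have [Dc _] := excess_energy m D a dir (t + s n) v (ts n) Dv.
    have [U [oU Uc Uv]] := vU n.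
    apply: (null_energy_vanishing _ U) => //.
      by move=> x; rewrite /excess le_max lexx orbT.
    by move=> x /Uv h; apply/max_idPr; rewrite subr_le0.
  - exists (4 * energy v) => n.
    by have [] := excess_energy m D a dir (t + s n) v (ts n) Dv.
  - by move=> n x; exact: excess_le.
  - by move=> x; exact: excess_cvg.
have DNu := dformZ_dom _ _ _ dir (-1) _ Du.
have Nneg : N (excess 0 (fun x => -1 * u x)).
  apply: Ncut => // n; exists [set r | - s n < r]; split; first exact: open_gt.
    by rewrite /=; have := s0 n; lra.
  by move=> x /=; rewrite mulN1r; lra.
have Npos : N (excess c u).
  apply: Ncut => // n; exists [set r | r < c + s n]; split; first exact: open_lt.
    by rewrite /=; have := s0 n; lra.
  by move=> x /= /ltW.
have uE : 0 < c -> N (trunc c u).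
  move=> c_gt0; have Dt := trunc_dom _ _ _ dir _ _ c_gt0 Du.
  (* Levels strictly between 0 and [c] that tend to [c]: being above [r n] is an open condition that
     [c] satisfies, and under it the truncation at [r n], divided by [r n], is 1. *)
  pose r (n : nat) := c * (n.+1%:R / n.+2%:R).
  have r0 n : 0 < r n by rewrite mulr_gt0// divr_gt0.
  have rc n : r n < c.
    by rewrite /r gtr_pMr// ltr_pdivrMr// mul1r ltr_nat.
  have Nr n : N (trunc (r n) u).
    have rn0 := r0 n; have Dr := trunc_dom _ _ _ dir _ _ rn0 Du.
    rewrite (_ : trunc (r n) u = fun x => r n * ((r n)^-1 * trunc (r n) u x)); last first.
      by apply/funext => x; rewrite mulrA mulfV ?mul1r// gt_eqF.
    apply: (null_energyZ m D a dir mu mu_energy I mI).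
    apply: (null_energy_constant1 _ [set t | r n < t]) => //.
    - exact: (dformZ_dom _ _ _ dir).
    - move=> x; rewrite mulr_ge0 ?invr_ge0 ?(ltW rn0)//=; last first.
        by rewrite /trunc le_min (ltW rn0) le_max lexx orbT.
      by rewrite mulrC ler_pdivrMr// mul1r /trunc ge_min lexx.
    - exact: rc.
    - move=> x /= rx; rewrite /trunc (max_idPl _); last by lra.
      by rewrite (min_idPl (ltW rx)) mulVf// gt_eqF.
  apply: (N_of _ (fun n => trunc (r n) u) u) => //.
  - exact: L2_of.
  - by exists (energy u) => n; exact: (energy_trunc _ _ _ dir).
  - move=> n x; have rn := r0 n; have rnc := rc n; rewrite /trunc.
    case: (leP (u x) 0) => u0.
      by rewrite (min_idPr c0) (min_idPr (ltW rn)) subrr normr0.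
    case: (leP c (u x)) => h; case: (leP (r n) (u x)) => h'; rewrite ?subrr ?normr0 ?ger0_norm//; lra.
  - move=> x; apply/cvgr0Pnorm_le => e e0.
    have ec : 0 < e / c by rewrite divr_gt0.
    have [n0 _ n0P] := near_infty_natSinv_lt (PosNum ec).
    exists n0 => // n n0n.
    have h1 : c - r n <= e.
      have -> : c - r n = c * n.+2%:R^-1.
        rewrite /r -[in X in X - _](mulr1 c) -mulrBr; congr (_ * _).
        have p0 : 0 < n.+1%:R :> R by rewrite ltr0n.
        rewrite -[n.+2%:R]natr1; move: (n.+1%:R) p0 => p p0.
        by field; rewrite gt_eqF// addr_gt0.
      rewrite mulrC -ler_pdivlMr// ltW//.
      apply: le_lt_trans (n0P n n0n); rewrite lef_pV2 ?posrE ?ltr0n//.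
      by rewrite ler_nat.
    have rn := r0 n; have rnc := rc n; rewrite /trunc ler_norml.
    by case: (leP c _) => h; case: (leP (r n) _) => h'; lra.
(* When c = 0 the middle summand is 0, and u = u^+ - u^-. *)
have [cE|cN0] := eqVneq c 0.
  have := null_energy_linear m D a dir mu mu_energy I mI (-1) _ _ Nneg Npos.
  congr N; apply/funext => x; rewrite /excess cE !subr0 !mulN1r.
  by case: (leP (u x) 0) => h; case: (leP (- u x) 0) => h'; lra.
have c_gt0 : 0 < c by rewrite lt0r cN0.
have := null_energy_linear m D a dir mu mu_energy I mI (-1) _ _ Nneg
  (null_energyD m D a dir mu mu_energy I mI _ _ Npos (uE c_gt0)).
congr N; apply/funext => x; rewrite /excess /trunc /= subr0 !mulN1r.
case: (leP (u x) 0) => h; case: (leP (- u x) 0) => h'; case: (leP (u x - c) 0) => h'';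
  rewrite ?(min_idPr c0); try lra;
by case: (leP c (u x)); lra.
Qed.

End level_sets.

(** * Reflection to negative levels, and conclusion *)

Lemma quasi_continuousN (R : realType) (X : ptopologicalType)
    (m : {measure set (borel X) -> \bar R}) (D : set (X -> R))
    (a : (X -> R) -> (X -> R) -> R) (u : X -> R) :
  quasi_continuous m D a u -> quasi_continuous m D a (fun x => -1 * u x).
Proof.
move=> [F [Fcl Fmono capF uF]]; exists F; split => // k x.
by apply: cvgM; [exact: cvg_cst|exact: uF].
Qed.

Theorem theorem3 (R : realType) (X : ptopologicalType)
  (X_hausdorff : hausdorff_space X)
  (X_locally_compact : locally_compact [set: X])
  (X_separable : separable_space X)
  (m : {measure set (borel X) -> \bar R})
  (m_radon : radon_measure m) (m_support : full_support m)
  (D : set (X -> R)) (a : (X -> R) -> (X -> R) -> R)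
  (a_dirichlet : dirichlet_form m D a)
  (a_local : strongly_local m D a)
  (mu : (X -> R) -> (X -> R) -> {charge set (borel X) -> \bar R})
  (mu_energy : energy_measure m D a mu)
  (a_compact : compact_embedding m D a)
  (a_cutoffs : has_cutoffs D)
  (a_continuous : continuous_dense m D a)
  (psi : X -> R) (psi_qc : quasi_continuous m D a psi)
  (K_nonempty : obstacle_set m D psi !=set0)
  (f : (X -> R) -> R) (f_dual : in_dual m D a f)
  (u : X -> R)
  (u_solution : obstacle_solution m D a psi f u)
  (u_unique : forall w : X -> R, obstacle_solution m D a psi f w ->
     {ae m, forall x, w x = u x})
  (u_qc : quasi_continuous m D a u) :
  let I := [set x | u x = psi x] in
  equation_on m D a u f (~` I) /\
  ((exists c : R, forall x, psi x = c) ->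
   forall v : X -> R, D v -> mu u v I = 0%E).
Proof.
split; first exact: obstacle_equation.
move=> [c psic] v Dv.
have [[Du _] _] := u_solution.
have -> : [set x | u x = psi x] = [set x | u x = c].
  by apply/seteqP; split => x /=; rewrite psic.
have mI : measurable ([set x | u x = c] : set (borel X)).
  rewrite -[X in measurable X]setTI.
  exact: (L2_measurable m u (df_L2 a_dirichlet Du) measurableT [set c] (measurable_set1 c)).
(* It suffices that the energy of [u] itself vanishes on the level set. *)
apply: (null_energy_cross m D a a_dirichlet mu mu_energy) => //.
have [c0|c0] := leP 0 c; first exact: (null_energy_level X_hausdorff X_locally_compact m D a).
(* For c < 0 the result for nonnegative levels is applied to -u at -c, which gives the same level
   set. *)
have DNu := dformZ_dom m D a a_dirichlet (-1) u Du.
have Nc0 : 0 <= - c by rewrite oppr_ge0 ltW.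
have := null_energy_level X_hausdorff X_locally_compact m D a a_dirichlet a_local mu mu_energy
  a_cutoffs a_continuous _ _ DNu (quasi_continuousN _ _ _ _ _ _ u_qc) Nc0.
have -> : [set x | -1 * u x = - c] = [set x | u x = c].
  by apply/seteqP; split => x /=; rewrite mulN1r; [exact: oppr_inj|move=> ->].
move=> /(null_energyZ m D a a_dirichlet mu mu_energy _ mI (-1)).
by congr null_energy; apply/funext => x; rewrite mulrA mulrNN !mul1r.
Qed.
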